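(* Suppose $U$ is a two-qubit unitary operator with Schmidt coefficients $s_0,s_1,s_2,s_3$ arranged in nonincreasing order. Then $\mu(U)=5$ if $s_0>s_1=s_2=s_3>0$, and $\mu(U)=4$ otherwise; in addition, $U$ can be verified by an entanglement-free protocol unless $s_0>s_1=s_2=s_3>0$.
   Context: The Schmidt coefficients of a two-qubit unitary $U$ on $\mathcal{H}_A\otimes\mathcal{H}_B$ are the Schmidt coefficients of its Choi state $U|\Phi\rangle_{AA'}\otimes|\Phi\rangle_{BB'}$ (with $|\Phi\rangle=\frac{1}{\sqrt2}\sum_k|kk\rangle$) with respect to the partition $AA'|BB'$. A verification protocol for $U$ consists of pure product input test states and, for each output state $U|\psi_j\rangle$, a verification protocol based on nonadaptive local projective measurements; it is ordinary if each output-state verification operator has positive spectral gap. One experimental setting means the preparation of a pure product input state together with one nonadaptive local projective measurement on the output state; $\mu(U)$ is the minimum number of experimental settings required to verify $U$ by ordinary protocols. A verification protocol is entanglement free if all input test states and the corresponding output states are product states and all measurements are local projective measurements. *)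

(* Defs.v *)
From HB Require Import structures.
From Stdlib Require List.
From mathcomp Require Import all_boot all_order all_algebra.
Set Implicit Arguments. Unset Strict Implicit. Unset Printing Implicit Defensive.
Import Order.TTheory GRing.Theory Num.Theory.
Local Open Scope ring_scope.

Section QubitDefs.
Variable C : numClosedFieldType.

(* computational basis of C^2 (x) C^2 = C^4 : |a b> <-> index 2a+b *)
Definition qidx (a b : 'I_2) : 'I_4 := inord (a * 2 + b).
Definition qfst (k : 'I_4) : 'I_2 := inord (k %/ 2).
Definition qsnd (k : 'I_4) : 'I_2 := inord (k %% 2).

Definition adjmx m n (A : 'M[C]_(m, n)) : 'M[C]_(n, m) := (map_mx Num.conj A)^T.
Definition unitary n (U : 'M[C]_n) : Prop := U *m adjmx U = 1%:M.
Definition inner n (x y : 'cV[C]_n) : C := (adjmx x *m y) 0 0.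
Definition unit_vec n (x : 'cV[C]_n) : Prop := inner x x = 1.

Definition kron2 (A B : 'M[C]_2) : 'M[C]_4 :=
  \matrix_(i, j) (A (qfst i) (qfst j) * B (qsnd i) (qsnd j)).
Definition kronv (x y : 'cV[C]_2) : 'cV[C]_4 :=
  \col_i (x (qfst i) 0 * y (qsnd i) 0).

(* Choi state of U : amplitude <a|_A <a'|_A' <b|_B <b'|_B' of
   (U (x) 1)|Phi>_{AA'} |Phi>_{BB'}, i.e. (1/2) <a b| U |a' b'>. *)
Definition choi (U : 'M[C]_4) (a a' b b' : 'I_2) : C :=
  2^-1 * U (qidx a b) (qidx a' b').

Definition orthonormal4 (v : 'I_4 -> 'I_2 -> 'I_2 -> C) : Prop :=
  forall i j : 'I_4,
    \sum_(a < 2) \sum_(a' < 2) v i a a' * (v j a a')^* = (i == j)%:R.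

(* s_0..s_3 are the Schmidt coefficients of the Choi state of U w.r.t. the
   partition AA'|BB': Psi = sum_i s_i |v_i>_{AA'} |w_i>_{BB'} with
   orthonormal {v_i}, {w_i} and s_i >= 0. *)
Definition schmidt_coeffs (U : 'M[C]_4) (s0 s1 s2 s3 : C) : Prop :=
  let s := fun i : 'I_4 => nth 0 [:: s0; s1; s2; s3] i in
  (forall i, 0 <= s i) /\
  exists v w : 'I_4 -> 'I_2 -> 'I_2 -> C,
    orthonormal4 v /\ orthonormal4 w /\
    forall a a' b b', choi U a a' b b' = \sum_(i < 4) s i * v i a a' * w i b b'.

Definition proj_meas (P : seq 'M[C]_2) : Prop :=
  (forall p, p \in P -> adjmx p = p /\ p *m p = p) /\ \sum_(p <- P) p = 1%:M.

(* a test based on a nonadaptive local projective measurement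
   (measure tA on qubit A and tB on qubit B, accept outcome (i,j) iff
   tacc i j), performed with probability tw *)
Record test := Test { tA : seq 'M[C]_2; tB : seq 'M[C]_2;
                      tacc : nat -> nat -> bool; tw : C }.

Definition test_op (t : test) : 'M[C]_4 :=
  \sum_(i < size (tA t)) \sum_(j < size (tB t))
     (if tacc t i j then kron2 (nth 0 (tA t) i) (nth 0 (tB t) j) else 0).

(* one entry: a pure product input state |inA> (x) |inB> and a verification
   protocol (list of tests) for the corresponding output state *)
Record entry := Entry { inA : 'cV[C]_2; inB : 'cV[C]_2; tests : seq test }.
Definition protocol := seq entry.

Definition input (e : entry) : 'cV[C]_4 := kronv (inA e) (inB e).
Definition output (U : 'M[C]_4) (e : entry) : 'cV[C]_4 := U *m input e.

Definition Omega (e : entry) : 'M[C]_4 := \sum_(t <- tests e) tw t *: test_op t.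

Definition valid_protocol (U : 'M[C]_4) (p : protocol) : Prop :=
  forall e, List.In e p ->
    [/\ unit_vec (inA e), unit_vec (inB e),
        \sum_(t <- tests e) tw t = 1 &
        forall t, List.In t (tests e) ->
          [/\ proj_meas (tA t), proj_meas (tB t), 0 < tw t &
              inner (output U e) (test_op t *m output U e) = 1]].

Definition kraus (K : seq 'M[C]_4) : Prop := \sum_(k <- K) adjmx k *m k = 1%:M.
Definition apply_ch (K : seq 'M[C]_4) (rho : 'M[C]_4) : 'M[C]_4 :=
  \sum_(k <- K) k *m rho *m adjmx k.

Definition passes (K : seq 'M[C]_4) (e : entry) (t : test) : Prop :=
  \tr (test_op t *m apply_ch K (input e *m adjmx (input e))) = 1.

Definition verifies (U : 'M[C]_4) (p : protocol) : Prop :=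
  valid_protocol U p /\
  forall K, kraus K ->
    (forall e t, List.In e p -> List.In t (tests e) -> passes K e t) ->
    forall rho, apply_ch K rho = U *m rho *m adjmx U.

(* ordinary: every output-state verification operator has a positive
   spectral gap, i.e. its largest eigenvalue 1 is nondegenerate *)
Definition ordinary (p : protocol) : Prop :=
  forall e, List.In e p -> \rank (eigenspace (Omega e) 1) = 1%N.

Definition settings (p : protocol) : nat := \sum_(e <- p) size (tests e).

Definition is_mu (U : 'M[C]_4) (n : nat) : Prop :=
  (exists p, [/\ verifies U p, ordinary p & settings p = n]) /\
  (forall p, verifies U p -> ordinary p -> (n <= settings p)%N).

(* entanglement free: inputs (by construction) and outputs are product states,
   measurements are local projective (by construction) *)
Definition entanglement_free (U : 'M[C]_4) (p : protocol) : Prop :=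
  forall e, List.In e p -> exists x y : 'cV[C]_2, output U e = kronv x y.

End QubitDefs.

(* Main.v *)
(* In the magic basis a vector is a product exactly when its coordinates satisfy
   sum phi_k^2 = 0, and U becomes O' diag(l) O with O, O' real orthogonal and
   |l_k| = 1, where O and O' are local up to a swap (which only changes the sign of
   one l_k). So product inputs with product outputs are the solutions of
   sum phi_k^2 = sum l_k^2 phi_k^2 = 0. If exactly three of the l_k^2 coincide, these
   equations force one fixed coordinate to vanish; otherwise some solution has no zero
   coordinate, and its sign changes give four independent product inputs with product
   outputs, one of them nonorthogonal to the others. The Schmidt coefficients of U are
   the moduli of a Hadamard transform of l, and three l_k^2 coincide exactly when
   s0 > s1 = s2 = s3 > 0. Product inputs verify U as soon as they span and one of them
   is nonorthogonal to all others; conversely they must span. A product output costs one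
   setting, an entangled output at least two, and two suffice. *)

(* A vector is a product exactly when its 2x2 amplitude matrix has determinant 0, and the magic
   basis turns this quadratic form into half a sum of squares. Orthogonal matrices therefore
   preserve the determinant form, and its isometries are local up to a swap because they map product
   vectors to product vectors. With [V] denoting [U] in the magic basis, [O] diagonalizes the
   symmetric unitary [V^T V], and [l] collects square roots of its eigenvalues. The two equations
   for product inputs and outputs are linear in [u_k = phi_k^2], so one solution [u] without zeros
   yields all sign choices of its square roots. Flipping the sign at [m] gives an inner product
   proportional to [sum |u_k| - 2 |u_m|]. If it vanishes, the triangle inequality is an equality
   both for [u] and for [l^2 u], and this forces all [l_k^2] to agree. Schmidt coefficients are
   compared only as a multiset of squares, through a characteristic polynomial. The link with [l] is
   that differences of squared moduli of the transform factor into binomials in the entries of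
   [l]. *)
Require Import Defs.
From HB Require Import structures.
From mathcomp Require Import all_boot all_order all_algebra.
From mathcomp Require Import perm ring.
Import Order.TTheory GRing.Theory Num.Theory.
Local Open Scope ring_scope.
Set Implicit Arguments. Unset Strict Implicit. Unset Printing Implicit Defensive.

(** * Adjoints, inner products and Kronecker products *)

Section Basics.
Variable C : numClosedFieldType.

Lemma adjmxK m n (A : 'M[C]_(m, n)) : adjmx (adjmx A) = A.
Proof. by apply/matrixP => i j; rewrite !mxE conjCK. Qed.

Lemma adjmxM m n p (A : 'M[C]_(m, n)) (B : 'M[C]_(n, p)) :
  adjmx (A *m B) = adjmx B *m adjmx A.
Proof. by rewrite /adjmx map_mxM trmx_mul. Qed.

Lemma adjmxD m n (A B : 'M[C]_(m, n)) : adjmx (A + B) = adjmx A + adjmx B.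
Proof. by rewrite /adjmx map_mxD linearD. Qed.

Lemma adjmxZ m n a (A : 'M[C]_(m, n)) : adjmx (a *: A) = a^* *: adjmx A.
Proof. by rewrite /adjmx map_mxZ linearZ. Qed.

Lemma adjmxB m n (A B : 'M[C]_(m, n)) : adjmx (A - B) = adjmx A - adjmx B.
Proof. by rewrite -scaleN1r adjmxD adjmxZ rmorphN1 scaleN1r. Qed.

Lemma adjmx0 m n : adjmx (0 : 'M[C]_(m, n)) = 0.
Proof. by rewrite /adjmx map_mx0 trmx0. Qed.

Lemma adjmx1 n : adjmx (1%:M : 'M[C]_n) = 1%:M.
Proof. by rewrite /adjmx map_mx1 trmx1. Qed.

Lemma adjmx_sum m n I (r : seq I) (P : pred I) (F : I -> 'M[C]_(m, n)) :
  adjmx (\sum_(i <- r | P i) F i) = \sum_(i <- r | P i) adjmx (F i).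
Proof. exact: (big_morph _ (@adjmxD m n) (@adjmx0 m n)). Qed.

Lemma unitaryP n (U : 'M[C]_n) : unitary U -> adjmx U *m U = 1%:M.
Proof. by move/mulmx1C. Qed.

Lemma unitary_adj n (U : 'M[C]_n) : unitary U -> unitary (adjmx U).
Proof. by rewrite /unitary adjmxK => /mulmx1C. Qed.

Lemma unitaryM n (U V : 'M[C]_n) : unitary U -> unitary V -> unitary (U *m V).
Proof.
by rewrite /unitary => hU hV; rewrite adjmxM mulmxA -(mulmxA U) hV mulmx1.
Qed.

Lemma innerE n (x y : 'cV[C]_n) : inner x y = \sum_k (x k 0)^* * y k 0.
Proof. by rewrite /inner mxE; apply: eq_bigr => k _; rewrite !mxE. Qed.

Lemma inner_conj n (x y : 'cV[C]_n) : (inner x y)^* = inner y x.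
Proof.
rewrite !innerE rmorph_sum; apply: eq_bigr => k _.
by rewrite rmorphM /= conjCK mulrC.
Qed.

Lemma innerDr n (x y z : 'cV[C]_n) : inner x (y + z) = inner x y + inner x z.
Proof. by rewrite /inner mulmxDr mxE. Qed.

Lemma innerZr n a (x y : 'cV[C]_n) : inner x (a *: y) = a * inner x y.
Proof. by rewrite /inner -scalemxAr mxE. Qed.

Lemma innerBr n (x y z : 'cV[C]_n) : inner x (y - z) = inner x y - inner x z.
Proof. by rewrite -scaleN1r innerDr innerZr mulN1r. Qed.

Lemma innerDl n (x y z : 'cV[C]_n) : inner (x + y) z = inner x z + inner y z.
Proof. by rewrite /inner adjmxD mulmxDl mxE. Qed.

Lemma innerZl n a (x y : 'cV[C]_n) : inner (a *: x) y = a^* * inner x y.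
Proof. by rewrite /inner adjmxZ -scalemxAl mxE. Qed.

Lemma innerBl n (x y z : 'cV[C]_n) : inner (x - y) z = inner x z - inner y z.
Proof. by rewrite -scaleN1r innerDl innerZl rmorphN1 mulN1r. Qed.

Lemma inner0r n (x : 'cV[C]_n) : inner x 0 = 0.
Proof. by rewrite /inner mulmx0 mxE. Qed.

Lemma inner_sumr n (x : 'cV[C]_n) I (r : seq I) (F : I -> 'cV[C]_n) :
  inner x (\sum_(i <- r) F i) = \sum_(i <- r) inner x (F i).
Proof. exact: (big_morph _ (@innerDr n x) (@inner0r n x)). Qed.

Lemma inner_mull n (A : 'M[C]_n) (x y : 'cV[C]_n) :
  inner (A *m x) y = inner x (adjmx A *m y).
Proof. by rewrite /inner adjmxM mulmxA. Qed.

Lemma inner_unitary n (U : 'M[C]_n) (x y : 'cV[C]_n) :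
  unitary U -> inner (U *m x) (U *m y) = inner x y.
Proof. by move=> hU; rewrite inner_mull mulmxA unitaryP // mul1mx. Qed.

Lemma inner_ge0 n (x : 'cV[C]_n) : 0 <= inner x x.
Proof.
rewrite innerE; apply: sumr_ge0 => k _.
by rewrite mulrC -normCK exprn_ge0.
Qed.

Lemma inner_eq0 n (x : 'cV[C]_n) : inner x x = 0 -> x = 0.
Proof.
rewrite innerE => /eqP.
rewrite psumr_eq0 => [/allP h|k _]; last by rewrite mulrC -normCK exprn_ge0.
apply/colP => k; rewrite mxE; apply/eqP.
have := h k (mem_index_enum _); rewrite /= mulrC -normCK.
by rewrite expf_eq0 /= normr_eq0.
Qed.

Lemma unit_vec_neq0 n (x : 'cV[C]_n) : unit_vec x -> x != 0.
Proof.
move=> h; apply/eqP => x0; move: h.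
by rewrite /unit_vec x0 inner0r => /eqP; rewrite eq_sym oner_eq0.
Qed.

Lemma unit_normalize n (x : 'cV[C]_n) : x != 0 ->
  exists2 r : C, 0 < r & r * r = inner x x /\ unit_vec (r^-1 *: x).
Proof.
move=> x0; have p : 0 < inner x x.
  rewrite lt_def inner_ge0 andbT; apply/eqP => /inner_eq0 x00.
  by rewrite x00 eqxx in x0.
have r0 : 0 < sqrtC (inner x x) by rewrite sqrtC_gt0.
exists (sqrtC (inner x x)) => //; rewrite -expr2 sqrtCK; split=> //.
rewrite /unit_vec innerZl innerZr (CrealP _); last first.
  by rewrite realV; apply: gtr0_real.
by rewrite -{3}(sqrtCK (inner x x)); field; rewrite gt_eqF.
Qed.

(** The squared norm of [z - E z] is [<z,z> - <z,E z>]. This is how passing a test with certainty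
    becomes a fixed-point equation. *)
Lemma proj_fix n (E : 'M[C]_n) (z : 'cV[C]_n) :
  adjmx E = E -> E *m E = E -> inner z (E *m z) = inner z z -> E *m z = z.
Proof.
move=> hE EE h; apply/eqP; rewrite -subr_eq0; apply/eqP; apply: inner_eq0.
rewrite innerBr !innerBl !inner_mull !hE !mulmxA !EE h; ring.
Qed.

Lemma proj_le n (E : 'M[C]_n) (z : 'cV[C]_n) :
  adjmx E = E -> E *m E = E -> inner z (E *m z) <= inner z z.
Proof.
move=> hE EE; rewrite -subr_ge0.
have -> : inner z z - inner z (E *m z) = inner (z - E *m z) (z - E *m z).
  by rewrite innerBr !innerBl !inner_mull !hE !mulmxA !EE; ring.
exact: inner_ge0.
Qed.

Lemma mx_ext n (A B : 'M[C]_n) :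
  (forall x : 'cV[C]_n, A *m x = B *m x) -> A = B.
Proof.
move=> h; apply/matrixP => i j; have /colP/(_ i) := h (delta_mx j 0).
by rewrite -!colE !mxE.
Qed.

Lemma mul_col_inner n (x y z : 'cV[C]_n) :
  (x *m adjmx y) *m z = inner y z *: x.
Proof. by rewrite -mulmxA [adjmx y *m z]mx11_scalar mul_mx_scalar. Qed.

Lemma qidxK1 a b : qfst (qidx a b) = a.
Proof.
by apply: val_inj; case: a => [[|[|a]] //= ha]; case: b => [[|[|b]] //= hb];
  rewrite /= !inordK //= inordK.
Qed.

Lemma qidxK2 a b : qsnd (qidx a b) = b.
Proof.
by apply: val_inj; case: a => [[|[|a]] //= ha]; case: b => [[|[|b]] //= hb];
  rewrite /= !inordK //= inordK.
Qed.

Lemma qidx_eta k : qidx (qfst k) (qsnd k) = k.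
Proof.
apply: val_inj; rewrite /= !inordK //;
  by case: k => [[|[|[|[|k]]]] //=].
Qed.

Lemma qidx_eq a b a' b' : (qidx a b == qidx a' b') = (a == a') && (b == b').
Proof.
apply/eqP/andP => [h|[/eqP -> /eqP ->] //].
split; apply/eqP; first by have := congr1 qfst h; rewrite !qidxK1.
by have := congr1 qsnd h; rewrite !qidxK2.
Qed.

Lemma sum_qidx (V : nmodType) (F : 'I_4 -> V) :
  \sum_k F k = \sum_a \sum_b F (qidx a b).
Proof.
rewrite pair_big /= (reindex (fun p : 'I_2 * 'I_2 => qidx p.1 p.2)) //=.
exists (fun k => (qfst k, qsnd k)) => [[a b] _|k _] /=.
  by rewrite qidxK1 qidxK2.
by rewrite qidx_eta.
Qed.

Lemma kron2M (A B A' B' : 'M[C]_2) :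
  kron2 A B *m kron2 A' B' = kron2 (A *m A') (B *m B').
Proof.
apply/matrixP => i j; rewrite !mxE sum_qidx mulr_suml; apply: eq_bigr => a _.
rewrite mulr_sumr; apply: eq_bigr => b _.
by rewrite !mxE qidxK1 qidxK2; ring.
Qed.

Lemma kron2_kronv (A B : 'M[C]_2) x y :
  kron2 A B *m kronv x y = kronv (A *m x) (B *m y).
Proof.
apply/matrixP => i j; rewrite !mxE sum_qidx mulr_suml; apply: eq_bigr => a _.
rewrite mulr_sumr; apply: eq_bigr => b _.
by rewrite !mxE qidxK1 qidxK2; ring.
Qed.

Lemma kron2_adj (A B : 'M[C]_2) : adjmx (kron2 A B) = kron2 (adjmx A) (adjmx B).
Proof. by apply/matrixP => i j; rewrite !mxE rmorphM. Qed.

Lemma kron2_1 : kron2 (1%:M : 'M[C]_2) 1%:M = 1%:M.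
Proof.
apply/matrixP => i j; rewrite !mxE -{3}(qidx_eta i) -{3}(qidx_eta j) qidx_eq.
by do 2!case: (_ == _); rewrite /= ?mul0r ?mulr0 ?mulr1.
Qed.

Lemma kron2Dr (A B B' : 'M[C]_2) : kron2 A (B + B') = kron2 A B + kron2 A B'.
Proof. by apply/matrixP => i j; rewrite !mxE mulrDr. Qed.

Lemma kron20l (B : 'M[C]_2) : kron2 0 B = 0.
Proof. by apply/matrixP => i j; rewrite !mxE mul0r. Qed.

Lemma kron20r (A : 'M[C]_2) : kron2 A 0 = 0.
Proof. by apply/matrixP => i j; rewrite !mxE mulr0. Qed.

Lemma kron2_unitary (A B : 'M[C]_2) : unitary A -> unitary B -> unitary (kron2 A B).
Proof. by rewrite /unitary kron2_adj kron2M => -> ->; rewrite kron2_1. Qed.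

Lemma kronvZl a (x y : 'cV[C]_2) : kronv (a *: x) y = a *: kronv x y.
Proof. by apply/colP => k; rewrite !mxE mulrA. Qed.

Lemma kronvZr a (x y : 'cV[C]_2) : kronv x (a *: y) = a *: kronv x y.
Proof. by apply/colP => k; rewrite !mxE mulrCA. Qed.

Lemma inner_kronv (x y x' y' : 'cV[C]_2) :
  inner (kronv x y) (kronv x' y') = inner x x' * inner y y'.
Proof.
rewrite !innerE sum_qidx mulr_suml; apply: eq_bigr => a _.
rewrite mulr_sumr; apply: eq_bigr => b _.
by rewrite !mxE qidxK1 qidxK2 rmorphM; ring.
Qed.

Lemma kron2_rank1 (x y x' y' : 'cV[C]_2) :
  kron2 (x *m adjmx x') (y *m adjmx y') = kronv x y *m adjmx (kronv x' y').
Proof.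
apply/matrixP => i j; rewrite !mxE !big_ord1 !mxE rmorphM; ring.
Qed.

(** The norm of [x] is moved onto [y], whose norm is then forced to be 1. *)
Lemma kronv_unit_factors (x y : 'cV[C]_2) : unit_vec (kronv x y) ->
  exists x' y' : 'cV[C]_2, [/\ unit_vec x', unit_vec y' & kronv x y = kronv x' y'].
Proof.
move=> h; have x0 : x != 0.
  apply: contraTneq (unit_vec_neq0 h) => ->.
  by apply/negPn/eqP/colP => k; rewrite !mxE mul0r.
have [r r0 [rr ux]] := unit_normalize x0.
exists (r^-1 *: x), (r *: y); split=> //; last first.
  by rewrite kronvZl kronvZr scalerA mulVf ?scale1r ?gt_eqF.
rewrite /unit_vec innerZl innerZr (CrealP _) ?gtr0_real // mulrA rr -inner_kronv.
exact: h.
Qed.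

End Basics.

(** * Local tests and verification of a unitary *)

(** A [test] contains the function [tacc], so membership in protocols is [List.In], without
    decidable equality; this and the next lemma serve sums over such lists. *)
Lemma eq_big_In (V : nmodType) T (s : seq T) (F G : T -> V) :
  (forall x, List.In x s -> F x = G x) -> \sum_(x <- s) F x = \sum_(x <- s) G x.
Proof.
elim: s => [|a s IH] h; first by rewrite !big_nil.
rewrite !big_cons h; last by left.
by rewrite IH // => x hx; apply: h; right.
Qed.

Lemma psum_eq0_In (R : numDomainType) T (s : seq T) (F : T -> R) :
  (forall x, List.In x s -> 0 <= F x) -> \sum_(x <- s) F x = 0 ->
  forall x, List.In x s -> F x = 0.
Proof.
elim: s => [|a s IH] //= h /eqP; rewrite big_cons paddr_eq0; last first.
- rewrite (eq_big_In (G := fun x => `|F x|)) ?sumr_ge0 // => x hx.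
  by rewrite ger0_norm // h //; right.
- by apply: h; left.
move=> /andP[/eqP Fa /eqP hs] x [<- //|]; apply: IH => // y hy.
by apply: h; right.
Qed.

Section Tests.
Variable C : numClosedFieldType.

Lemma proj_meas_nth (P : seq 'M[C]_2) i : proj_meas P ->
  adjmx (nth 0 P i) = nth 0 P i /\ nth 0 P i *m nth 0 P i = nth 0 P i.
Proof.
move=> [h _]; have [lt|ge] := ltnP i (size P); first by apply: h; apply: mem_nth.
by rewrite nth_default // adjmx0 mulmx0.
Qed.

(** [proj_meas] only asks for projectors with sum 1; orthogonality follows by counting norms. On a
    vector fixed by the [j]th projector, the squared norms of all images add up to its own squared
    norm, which the [j]th image already exhausts. *)
Lemma proj_meas_orth (P : seq 'M[C]_2) (i j : 'I_(size P)) : proj_meas P -> i != j ->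
  nth 0 P i *m nth 0 P j = 0.
Proof.
move=> hP neq; have hn k := proj_meas_nth k hP.
have sum1 : \sum_(k < size P) nth 0 P k = 1%:M.
  by rewrite -hP.2 (big_nth 0) big_mkord.
apply: mx_ext => x; rewrite mul0mx.
pose y k := nth 0 P k *m (nth 0 P j *m x).
have sqr k : inner (y k) (y k) = inner (nth 0 P j *m x) (y k).
  by rewrite /y inner_mull (hn k).1 (mulmxA (nth 0 P k)) (hn k).2.
have tot : \sum_(k < size P | k != j) inner (y k) (y k) = 0.
  have : \sum_(k < size P) inner (y k) (y k) = inner (y j) (y j).
    under eq_bigr do rewrite sqr.
    rewrite -inner_sumr -mulmx_suml sum1 mul1mx.
    by rewrite sqr /y mulmxA (hn j).2.
  by rewrite (bigD1 j) //= -[RHS]addr0 => /addrI.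
rewrite -mulmxA; apply: inner_eq0; apply/eqP.
have /eqP := tot; rewrite psumr_eq0 => [/allP /(_ i (mem_index_enum _))|k _].
  by rewrite neq.
exact: inner_ge0.
Qed.

Section OneTest.
Variable t : test C.
Hypotheses (hA : proj_meas (tA t)) (hB : proj_meas (tB t)).

Let T (p : 'I_(size (tA t)) * 'I_(size (tB t))) : 'M[C]_4 :=
  if tacc t p.1 p.2 then kron2 (nth 0 (tA t) p.1) (nth 0 (tB t) p.2) else 0.

Lemma test_op_pairs : test_op t = \sum_p T p.
Proof. by rewrite /test_op pair_big. Qed.

Let TT p q : T p *m T q = if p == q then T p else 0.
Proof.
rewrite /T; case: eqP => [->|neq].
  case: ifP => _; last by rewrite mul0mx.
  by rewrite kron2M (proj_meas_nth _ hA).2 (proj_meas_nth _ hB).2.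
case: ifP => _; last by rewrite mul0mx.
case: ifP => _; last by rewrite mulmx0.
case: p q neq => [i j] [i' j'] neq /=; rewrite kron2M.
have [ii|nii] := eqVneq i i'; last by rewrite (proj_meas_orth hA nii) kron20l.
have [jj|njj] := eqVneq j j'; last by rewrite (proj_meas_orth hB njj) kron20r.
by case: neq; rewrite ii jj.
Qed.

Lemma test_op_adj : adjmx (test_op t) = test_op t.
Proof.
rewrite test_op_pairs adjmx_sum; apply: eq_bigr => p _; rewrite /T.
case: ifP => _; last by rewrite adjmx0.
by rewrite kron2_adj (proj_meas_nth _ hA).1 (proj_meas_nth _ hB).1.
Qed.

Let ET p : test_op t *m T p = T p.
Proof.
rewrite test_op_pairs mulmx_suml (bigD1 p) //= TT eqxx big1 ?addr0 // => q neq.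
by rewrite TT (negPf neq).
Qed.

Lemma test_op_idem : test_op t *m test_op t = test_op t.
Proof.
by rewrite {2 3}test_op_pairs mulmx_sumr; apply: eq_bigr => p _; rewrite ET.
Qed.

Lemma test_op_kronv i j (x y : 'cV[C]_2) : (i < size (tA t))%N -> (j < size (tB t))%N ->
  tacc t i j -> nth 0 (tA t) i *m x = x -> nth 0 (tB t) j *m y = y ->
  test_op t *m kronv x y = kronv x y.
Proof.
move=> hi hj acc ex ey.
have <- : T (Ordinal hi, Ordinal hj) *m kronv x y = kronv x y.
  by rewrite /T /= acc kron2_kronv ex ey.
by rewrite mulmxA ET.
Qed.

Lemma mulmx_neq0_col n (A : 'M[C]_n) : A != 0 -> exists x : 'cV[C]_n, A *m x != 0.
Proof.
move=> A0; have [j hj|h] := pickP (fun j => col j A != 0).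
  by exists (delta_mx j 0); rewrite -colE.
case/eqP: A0; apply/matrixP => i j; rewrite mxE.
by have /negbFE/eqP/colP/(_ i) := h j; rewrite !mxE.
Qed.

(* Some accepted outcome has nonzero probability on [z], so the support of [E]
   contains a product vector. *)
Lemma test_op_product (z : 'cV[C]_4) : z != 0 -> test_op t *m z = z ->
  exists x y : 'cV[C]_2, kronv x y != 0 /\ test_op t *m kronv x y = kronv x y.
Proof.
move=> z0 hz; have [p hp|h] := pickP (fun p => T p != 0); last first.
  case/eqP: z0; rewrite -hz test_op_pairs big1 ?mul0mx // => p _.
  by have /negbFE/eqP := h p.
move: (hp); rewrite /T; case: ifP => [acc hk|_]; last by rewrite eqxx.
have A0 : nth 0 (tA t) p.1 != 0 by apply: contraNneq hk => ->; rewrite kron20l.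
have B0 : nth 0 (tB t) p.2 != 0 by apply: contraNneq hk => ->; rewrite kron20r.
have [x hx] := mulmx_neq0_col A0; have [y hy] := mulmx_neq0_col B0.
exists (nth 0 (tA t) p.1 *m x), (nth 0 (tB t) p.2 *m y); split; last first.
  apply: (@test_op_kronv p.1 p.2) => //; rewrite mulmxA.
    by rewrite (proj_meas_nth _ hA).2.
  by rewrite (proj_meas_nth _ hB).2.
apply/eqP => /(congr1 (fun v => inner v v)); rewrite inner0r inner_kronv.
move/eqP; rewrite mulf_eq0 => /orP[] /eqP /inner_eq0 e0.
  by rewrite e0 eqxx in hx.
by rewrite e0 eqxx in hy.
Qed.

End OneTest.

(** [eigenspace] consists of row vectors; since [W] is self-adjoint and the eigenvalue 1 is real,
    adjoints translate to columns. *)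
Lemma eigenspace_col (W : 'M[C]_4) (z : 'cV[C]_4) : adjmx W = W ->
  (adjmx z <= eigenspace W 1)%MS = (W *m z == z).
Proof.
move=> hW; apply/eigenspaceP/eqP; rewrite scale1r.
  by move=> /(congr1 (@adjmx C _ _)); rewrite adjmxM !adjmxK hW.
by move=> h; rewrite -{1}hW -adjmxM h.
Qed.

Lemma rank1_eigenspace (W : 'M[C]_4) (psi : 'cV[C]_4) :
  adjmx W = W -> psi != 0 -> W *m psi = psi ->
  \rank (eigenspace W 1) = 1%N <->
  (forall z : 'cV[C]_4, W *m z = z -> exists c, z = c *: psi).
Proof.
move=> hW psi0 hpsi.
have adj0 : adjmx psi != 0.
  by apply: contraNneq psi0 => h; rewrite -(adjmxK psi) h adjmx0.
have sub : (adjmx psi <= eigenspace W 1)%MS by rewrite eigenspace_col ?hpsi.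
have r1 : \rank (adjmx psi) = 1%N by rewrite rank_rV adj0.
split=> [r z hz|h].
  have /eqmxP e : (adjmx psi == eigenspace W 1)%MS.
    by rewrite -(geq_leqif (mxrank_leqif_eq sub)) r r1.
  have : (adjmx z <= adjmx psi)%MS by rewrite e eigenspace_col // hz.
  move=> /sub_rVP [c /(congr1 (@adjmx C _ _))]; rewrite adjmxZ !adjmxK.
  by move=> ->; exists c^*.
apply/eqP; rewrite eqn_leq; apply/andP; split; last first.
  by rewrite -[X in (X <= _)%N]r1 mxrankS.
rewrite -[X in (_ <= X)%N]r1; apply: mxrankS.
apply/rV_subP => v; rewrite -{1}(adjmxK v) eigenspace_col // => /eqP /h [c hc].
by rewrite -(adjmxK v) hc adjmxZ scalemx_sub.
Qed.

(** The condition of [valid_protocol] on a single entry, isolated so that entries can be built one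
    at a time. *)
Definition valid_entry (U : 'M[C]_4) (e : entry C) : Prop :=
  [/\ unit_vec (inA e), unit_vec (inB e),
      \sum_(t <- tests e) tw t = 1 &
      forall t, List.In t (tests e) ->
        [/\ proj_meas (tA t), proj_meas (tB t), 0 < tw t &
            inner (output U e) (test_op t *m output U e) = 1]].

Lemma input_unit U e : valid_entry U e -> unit_vec (input e).
Proof.
by case=> hA hB _ _; rewrite /unit_vec /input inner_kronv hA hB mul1r.
Qed.

Lemma output_unit U e : unitary U -> valid_entry U e -> unit_vec (output U e).
Proof.
by move=> hU /input_unit he; rewrite /unit_vec /output inner_unitary.
Qed.

Section OneEntry.
Variables (U : 'M[C]_4) (e : entry C).
Hypotheses (hU : unitary U) (he : valid_entry U e).

Lemma Omega_adj : adjmx (Omega e) = Omega e.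
Proof.
rewrite /Omega adjmx_sum; apply: eq_big_In => t ht; rewrite adjmxZ.
have [_ _ _ /(_ t ht) [hA hB w0 _]] := he.
by rewrite test_op_adj // (CrealP _) ?gtr0_real.
Qed.

Lemma test_output t : List.In t (tests e) ->
  test_op t *m output U e = output U e.
Proof.
move=> ht; have [_ _ _ /(_ t ht) [hA hB w0 h1]] := he.
apply: proj_fix; rewrite ?test_op_adj ?test_op_idem // h1.
by rewrite (output_unit hU he).
Qed.

(** [<z, Omega z>] is an average, with positive weights, of numbers that are at most [<z,z>]; it
    reaches [<z,z>] only if every one of them does. *)
Lemma Omega_fixP (z : 'cV[C]_4) :
  Omega e *m z = z <-> forall t, List.In t (tests e) -> test_op t *m z = z.
Proof.
have [_ _ hw ht] := he; split=> [h t int|h].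
  have hpos x : List.In x (tests e) ->
      0 <= tw x * (inner z z - inner z (test_op x *m z)).
    move=> inx; have [hA hB w0 _] := ht x inx.
    apply: mulr_ge0; first exact: ltW.
    by rewrite subr_ge0 proj_le ?test_op_adj ?test_op_idem.
  have tot : \sum_(x <- tests e) tw x * (inner z z - inner z (test_op x *m z)) = 0.
    under eq_bigr => x _ do rewrite mulrBr -[X in _ - X]innerZr scalemxAl.
    rewrite big_split /= -mulr_suml hw mul1r sumrN -inner_sumr -mulmx_suml.
    by rewrite -/(Omega e) h subrr.
  have [hA hB w0 _] := ht t int.
  apply: proj_fix; rewrite ?test_op_adj ?test_op_idem //.
  have /eqP := psum_eq0_In hpos tot int.
  by rewrite mulf_eq0 gt_eqF //= subr_eq0 eq_sym => /eqP.
rewrite /Omega mulmx_suml.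
rewrite (eq_big_In (G := fun t => tw t *: z)) => [|t int].
  by rewrite -scaler_suml hw scale1r.
by rewrite -scalemxAl h.
Qed.

(** All tests fix the output, so nondegeneracy of the eigenvalue 1 means that only its multiples
    pass every test. The spectral gap is used in this form only. *)
Lemma ordinary_entryP :
  \rank (eigenspace (Omega e) 1) = 1%N <->
  (forall z : 'cV[C]_4, (forall t, List.In t (tests e) -> test_op t *m z = z) ->
     exists c, z = c *: output U e).
Proof.
have o0 : output U e != 0 by apply: unit_vec_neq0; exact: output_unit.
have fo : Omega e *m output U e = output U e by apply/Omega_fixP/test_output.
rewrite (rank1_eigenspace Omega_adj o0 fo).
by split=> h z hz; apply: h; apply/Omega_fixP.
Qed.

(** The support of a single local test contains a product vector; by nondegeneracy that vector is a
    multiple of the output. *)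
Lemma single_test_product : \rank (eigenspace (Omega e) 1) = 1%N ->
  size (tests e) = 1%N -> exists x y : 'cV[C]_2, output U e = kronv x y.
Proof.
move=> /ordinary_entryP hr; case E: (tests e) => [|t [|]] // _.
have int : List.In t (tests e) by rewrite E; left.
have [_ _ _ /(_ t int) [hA hB _ _]] := he.
have o0 : output U e != 0 by apply: unit_vec_neq0; exact: output_unit.
have [x [y [xy0 hxy]]] := test_op_product hA hB o0 (test_output int).
have [|c hc] := hr (kronv x y); first by rewrite E => s [<-|].
have c0 : c != 0 by apply: contraNneq xy0 => c0; rewrite hc c0 scale0r.
exists (c^-1 *: x), y; rewrite kronvZl hc scalerA mulVf ?scale1r //.
Qed.

Lemma tests_neq0 : (0 < size (tests e))%N.
Proof.
have [_ _ + _] := he; case: (tests e) => //=; rewrite big_nil => /eqP.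
by rewrite eq_sym oner_eq0.
Qed.

End OneEntry.

Lemma trace_outer n (A : 'M[C]_n) (x : 'cV[C]_n) :
  \tr (A *m (x *m adjmx x)) = inner x (A *m x).
Proof. by rewrite mulmxA mxtrace_mulC /inner mulmxA [LHS]trace_mx11. Qed.

(** The acceptance probability is the sum over [K] of [<k x, T k x>], each term being at most
    [<k x, k x>], and these bounds add up to 1. Hence every Kraus operator saturates its bound. *)
Lemma passes_fix K (e : entry C) (t : test C) : 
  kraus K -> proj_meas (tA t) -> proj_meas (tB t) ->
  unit_vec (input e) -> passes K e t ->
  forall k, k \in K -> test_op t *m (k *m input e) = k *m input e.
Proof.
move=> hK hA hB hi; rewrite /passes /apply_ch mulmx_sumr raddf_sum /= => h k kK.
have tot : \sum_(j <- K) (inner (j *m input e) (j *m input e) -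
    inner (j *m input e) (test_op t *m (j *m input e))) = 0.
  rewrite big_split /= sumrN.
  have -> : \sum_(j <- K) inner (j *m input e) (j *m input e) = 1.
    rewrite -hi; under eq_bigr do rewrite inner_mull mulmxA.
    by rewrite -inner_sumr -mulmx_suml hK mul1mx.
  apply/eqP; rewrite subr_eq0 -[X in X == _]h; apply/eqP/eq_bigr => j _.
  by rewrite -trace_outer adjmxM !mulmxA.
apply: proj_fix; rewrite ?test_op_adj ?test_op_idem //.
have /eqP := tot; rewrite psumr_eq0 => [/allP /(_ k kK) /=|j _]; last first.
  by rewrite subr_ge0 proj_le ?test_op_adj ?test_op_idem.
by rewrite subr_eq0 eq_sym => /eqP.
Qed.

(* A channel passing all tests has Kraus operators [k] acting on each input as a
   multiple of [U]; nonorthogonality to the input of [e0] makes the multiples agree. *)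
Lemma verifies_star (U : 'M[C]_4) p e0 : unitary U -> valid_protocol U p -> ordinary p ->
  List.In e0 p ->
  (forall e, List.In e p -> inner (input e0) (input e) != 0) ->
  (forall z, (forall e, List.In e p -> inner z (input e) = 0) -> z = 0) ->
  verifies U p.
Proof.
move=> hU hv ho in0 star span; split=> // K hK pass rho.
pose c e k := inner (output U e) (k *m input e).
have kc e k : List.In e p -> k \in K -> k *m input e = c e k *: output U e.
  move=> ine kK; have he : valid_entry U e := hv e ine.
  have [|a ha] := (ordinary_entryP hU he).1 (ho e ine) (k *m input e).
    move=> t int; have [_ _ _ /(_ t int) [hA hB _ _]] := he.
    by apply: (passes_fix hK) => //; [apply: input_unit he | apply: pass].
  by rewrite /c ha innerZr (output_unit hU he) mulr1.
(* By the Kraus condition, the sum of [<k x, k x'>] over [K] is [<x, x'>]; since [k] acts on inputs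
   as multiples of [U], the same sum is also the Gram sum of the multiples times [<x, x'>]. *)
have cc e e' : List.In e p -> List.In e' p ->
    (\sum_(k <- K) (c e k)^* * c e' k) * inner (input e) (input e') =
    inner (input e) (input e').
  move=> ine ine'; transitivity (\sum_(k <- K) inner (k *m input e) (k *m input e')).
    rewrite mulr_suml; apply: eq_big_seq => k kK.
    rewrite (kc e) // (kc e') // innerZl innerZr.
    by rewrite [in RHS]/output inner_unitary // mulrA.
  under eq_bigr do rewrite inner_mull mulmxA.
  by rewrite -inner_sumr -mulmx_suml hK mul1mx.
have cs e e' : List.In e p -> List.In e' p -> inner (input e) (input e') != 0 ->
    \sum_(k <- K) (c e k)^* * c e' k = 1.
  by move=> ine ine' nz; apply: (mulIf nz); rewrite mul1r cc.
have self e : List.In e p -> inner (input e) (input e) != 0.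
  by move=> ine; rewrite (input_unit (hv e ine)) oner_eq0.
have eqc e k : List.In e p -> k \in K -> c e k = c e0 k.
  move=> ine kK.
  (* The expanded square is 1 - 1 - 1 + 1. Nonorthogonality to the input of [e0] is what gives the
     two mixed sums their value. *)
  have tot : \sum_(j <- K) `|c e j - c e0 j| ^+ 2 = 0.
    transitivity (\sum_(j <- K) ((c e j)^* * c e j - (c e j)^* * c e0 j
        - (c e0 j)^* * c e j + (c e0 j)^* * c e0 j)).
      by apply: eq_bigr => j _; rewrite normCK rmorphB; ring.
    rewrite !big_split /= !sumrN !cs //; try exact: self; try exact: star.
      by ring.
    by rewrite -inner_conj conjC_eq0; exact: star.
  have /eqP := tot; rewrite psumr_eq0 => [/allP /(_ k kK) /=|j _]; last first.
    by rewrite exprn_ge0.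
  by rewrite expf_eq0 /= normr_eq0 subr_eq0 => /eqP.
have kU k : k \in K -> k = c e0 k *: U.
  move=> kK; apply/eqP; rewrite -subr_eq0; apply/eqP.
  (* The spanning hypothesis speaks of orthogonality, so it is applied to the adjoint of [k - c U]:
     each of its values is orthogonal to all inputs. *)
  rewrite -[LHS]adjmxK; rewrite -[RHS](adjmx0 C 4 4); congr adjmx.
  apply: mx_ext => w; rewrite mul0mx; apply: span => e ine.
  rewrite inner_mull adjmxK mulmxBl kc // eqc // -scalemxAl /output subrr.
  exact: inner0r.
transitivity ((\sum_(k <- K) (c e0 k)^* * c e0 k) *: (U *m rho *m adjmx U)).
  rewrite scaler_suml; apply: eq_big_seq => k kK; rewrite {1 2}(kU k kK).
  by rewrite adjmxZ -!scalemxAl -!scalemxAr scalerA mulrC.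
by rewrite cs ?scale1r //; exact: self.
Qed.

(* Otherwise [U] followed the reflection in the hyperplane orthogonal to [z] would
   pass every test as well. *)
Lemma verifies_span (U : 'M[C]_4) p : unitary U -> verifies U p ->
  forall z, (forall e, List.In e p -> inner z (input e) = 0) -> z = 0.
Proof.
move=> hU [hv hver] z hz; apply/eqP/negPn/negP => z0.
have [r r0 [_ uz]] := unit_normalize z0; set y := r^-1 *: z in uz.
have hy e : List.In e p -> inner y (input e) = 0.
  by move=> ine; rewrite innerZl hz // mulr0.
pose V : 'M[C]_4 := 1%:M - 2%:R *: (y *m adjmx y).
have Vx x : V *m x = x - (2%:R * inner y x) *: y.
  by rewrite mulmxBl mul1mx -scalemxAl mul_col_inner scalerA.
have Vadj : adjmx V = V.
  by rewrite adjmxB adjmx1 adjmxZ adjmxM adjmxK conjC_nat.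
have VV : V *m V = 1%:M.
  apply: mx_ext => x; rewrite -mulmxA !Vx innerBr innerZr uz mul1mx mulr1.
  rewrite -addrA -opprD -scalerDl [X in X *: y](_ : _ = 0) ?scale0r ?subr0 //.
  by ring.
have hK : kraus [:: U *m V].
  by rewrite /kraus big_seq1 adjmxM Vadj mulmxA -(mulmxA V) unitaryP // mulmx1.
have pass e t : List.In e p -> List.In t (tests e) -> passes [:: U *m V] e t.
  move=> ine int; rewrite /passes /apply_ch big_seq1.
  have he : valid_entry U e := hv e ine.
  have [_ _ _ /(_ t int) [_ _ _ <-]] := he.
  rewrite -trace_outer; congr (\tr (_ *m _)).
  rewrite mulmxA -mulmxA -adjmxM -[U *m V *m _]mulmxA Vx hy // mulr0 scale0r.
  by rewrite subr0.
(* [V] fixes [x] and negates [y], so the coherence [x adjmx y] tells the channel of [U V] from that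
   of [U]. *)
have [x x0 hxy] : exists2 x : 'cV[C]_4, x != 0 & inner y x = 0.
  pose B := adjmx y; have : (0 < \rank (kermx B^T))%N.
    by rewrite mxrank_ker subn_gt0; apply: leq_ltn_trans (rank_leq_col _) _.
  rewrite lt0n mxrank_eq0 => /rowV0Pn [v /sub_kermxP hv0 v0]; exists v^T.
    by rewrite trmx_eq0.
  by rewrite /inner -[adjmx y]trmxK -trmx_mul hv0 !mxE.
have outer k : k *m (x *m adjmx y) *m adjmx k = (k *m x) *m adjmx (k *m y).
  by rewrite adjmxM !mulmxA.
have := hver _ hK pass (x *m adjmx y); rewrite /apply_ch big_seq1 !outer.
have -> : U *m V *m x = U *m x by rewrite -mulmxA Vx hxy mulr0 scale0r subr0.
have -> : U *m V *m y = - (U *m y).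
  by rewrite -mulmxA Vx uz mulr1 scaler_nat mulr2n opprD addrA subrr add0r mulmxN.
move=> /(congr1 (fun A => A *m (U *m y))).
rewrite -scaleN1r adjmxZ -scalemxAr -scalemxAl mul_col_inner inner_unitary // uz.
rewrite rmorphN1 scaleN1r scale1r => /eqP; rewrite eq_sym -addr_eq0 -mulr2n.
rewrite -scaler_nat scaler_eq0 pnatr_eq0 /= => /eqP Ux0.
case/eqP: x0; apply: inner_eq0.
by rewrite -(inner_unitary _ _ hU) Ux0 inner0r.
Qed.

End Tests.

(** * Optimal tests for one output state *)

Section Entries.
Variable C : numClosedFieldType.
Implicit Types (U : 'M[C]_4) (x y p q : 'cV[C]_2).

Definition proj1 x := x *m adjmx x.
Definition proj_test x y (acc : nat -> nat -> bool) (w : C) : test C :=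
  Test [:: proj1 x; 1%:M - proj1 x] [:: proj1 y; 1%:M - proj1 y] acc w.

Lemma proj_meas_proj1 x : unit_vec x -> proj_meas [:: proj1 x; 1%:M - proj1 x].
Proof.
move=> ux; have h : adjmx (proj1 x) = proj1 x by rewrite adjmxM adjmxK.
have hh : proj1 x *m proj1 x = proj1 x by rewrite mulmxA mul_col_inner ux scale1r.
split=> [P|]; last by rewrite big_cons big_seq1 addrC subrK.
rewrite !inE => /orP[] /eqP ->; first by [].
split; first by rewrite adjmxB adjmx1 h.
by rewrite mulmxBl !mulmxBr !mul1mx mulmx1 hh subrr subr0.
Qed.

Lemma test_op_proj_test x y acc w : test_op (proj_test x y acc w) =
  (if acc 0%N 0%N then kron2 (proj1 x) (proj1 y) else 0) +
  (if acc 0%N 1%N then kron2 (proj1 x) (1%:M - proj1 y) else 0) +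
  ((if acc 1%N 0%N then kron2 (1%:M - proj1 x) (proj1 y) else 0) +
   (if acc 1%N 1%N then kron2 (1%:M - proj1 x) (1%:M - proj1 y) else 0)).
Proof. by rewrite /test_op /= !big_ord_recl !big_ord0 !addr0. Qed.

(** Measuring in bases that contain the two normalized factors of the output and accepting only the
    outcome [(0,0)] gives the rank-one projector onto the output. *)
Lemma product_entry U x y (x' y' : 'cV[C]_2) : unitary U ->
  unit_vec x -> unit_vec y -> U *m kronv x y = kronv x' y' ->
  exists e, [/\ valid_entry U e, input e = kronv x y, size (tests e) = 1%N &
    \rank (eigenspace (Omega e) 1) = 1%N].
Proof.
move=> hU ux uy; have : unit_vec (U *m kronv x y).
  by rewrite /unit_vec inner_unitary // inner_kronv ux uy mulr1.
move=> + eU; rewrite eU => /kronv_unit_factors [x0 [y0 [ux0 uy0 exy]]].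
rewrite exy in eU; clear x' y' exy.
pose t := proj_test x0 y0 (fun i j => (i == 0%N) && (j == 0%N)) 1.
pose e := Entry x y [:: t].
have tE : test_op t = kronv x0 y0 *m adjmx (kronv x0 y0).
  by rewrite test_op_proj_test /= !addr0 kron2_rank1.
have oE : output U e = kronv x0 y0 by [].
have uo : unit_vec (kronv x0 y0) by rewrite /unit_vec inner_kronv ux0 uy0 mulr1.
have ve : valid_entry U e.
  split=> //; first by rewrite big_seq1.
  move=> s [<-|[]]; split; rewrite ?ltr01 //; try exact: proj_meas_proj1.
  by rewrite oE tE mul_col_inner innerZr uo mulr1.
exists e; split=> //; apply/(ordinary_entryP hU ve) => z h; rewrite oE.
have := h t (or_introl erefl); rewrite tE mul_col_inner => <-; by eexists.
Qed.

(* Two settings single out [a pq + b p'q']: the Schmidt bases, and the rejection of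
   a product state orthogonal to it. *)
Lemma entangled_entry U x y p p' q q' a b : unitary U ->
  unit_vec x -> unit_vec y ->
  unit_vec p -> unit_vec q -> unit_vec p' -> unit_vec q' ->
  inner p p' = 0 -> inner q q' = 0 ->
  proj1 p + proj1 p' = 1%:M -> proj1 q + proj1 q' = 1%:M ->
  U *m kronv x y = a *: kronv p q + b *: kronv p' q' -> a != 0 ->
  exists e, [/\ valid_entry U e, input e = kronv x y, size (tests e) = 2%N &
    \rank (eigenspace (Omega e) 1) = 1%N].
Proof.
move=> hU ux uy up uq up' uq' pp qq Hp Hq eU a0.
have pp' : inner p' p = 0 by rewrite -inner_conj pp conjC0.
have qq' : inner q' q = 0 by rewrite -inner_conj qq conjC0.
have Up : unit_vec (U *m kronv x y).
  by rewrite /unit_vec inner_unitary // inner_kronv ux uy mulr1.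
have nab : a * a^* + b * b^* = 1.
  rewrite -Up eU innerDl !innerDr !innerZl !innerZr !inner_kronv.
  by rewrite up uq up' uq' pp qq pp' qq'; ring.
have [h h0 hh] : exists2 h : C, 0 < h & h * h * 2%:R = 1.
  exists (sqrtC 2%:R^-1); first by rewrite sqrtC_gt0 invr_gt0 ltr0n.
  by rewrite -expr2 sqrtCK mulVf // pnatr_eq0.
have hc : h^* = h by rewrite (CrealP _) // gtr0_real.
(* [s] has equal weight [h = 1/sqrt 2] on [q] and [q'], and [r] is chosen to make [r s] orthogonal
   to the output: the inner product is [h (b a - a b)]. *)
pose r := b^* *: p - a^* *: p'; pose s := h *: (q + q').
have ur : unit_vec r.
  rewrite /unit_vec /r innerBl !innerBr !innerZl !innerZr up up' pp pp' !conjCK.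
  by rewrite -[RHS]nab; ring.
have us : unit_vec s.
  rewrite /unit_vec /s innerZl innerZr innerDl !innerDr uq uq' qq qq' hc -[RHS]hh.
  by ring.
pose t1 := proj_test p q (fun i j => i == j) 2^-1.
pose t2 := proj_test r s (fun i j => ~~ ((i == 0%N) && (j == 0%N))) 2^-1.
pose e := Entry x y [:: t1; t2].
have Hp' : 1%:M - proj1 p = proj1 p' by rewrite -Hp addrC addKr.
have Hq' : 1%:M - proj1 q = proj1 q' by rewrite -Hq addrC addKr.
have t1E z : test_op t1 *m z = inner (kronv p q) z *: kronv p q
    + inner (kronv p' q') z *: kronv p' q'.
  rewrite test_op_proj_test /= !addr0 add0r Hp' Hq' !kron2_rank1 mulmxDl.
  by rewrite !mul_col_inner.
have t2E z : test_op t2 *m z = z - inner (kronv r s) z *: kronv r s.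
  rewrite test_op_proj_test /= add0r -kron2Dr [proj1 s + _]addrC subrK.
  have -> : kron2 (proj1 r) (1%:M - proj1 s) + kron2 (1%:M - proj1 r) 1%:M
      = 1%:M - kronv r s *m adjmx (kronv r s).
    rewrite -kron2_rank1 -kron2_1.
    by apply/matrixP => i j; rewrite !mxE; ring.
  by rewrite mulmxBl mul1mx mul_col_inner.
have oE : output U e = a *: kronv p q + b *: kronv p' q' by [].
have rs : inner (kronv r s) (output U e) = 0.
  rewrite oE innerDr !innerZr !inner_kronv /r /s !innerBl !innerZl !innerDl.
  by rewrite up uq up' uq' pp qq pp' qq' !conjCK; ring.
have f1 : test_op t1 *m output U e = output U e.
  rewrite t1E oE !innerDr !innerZr !inner_kronv up uq up' uq' pp pp' qq qq'.
  by congr (_ *: _ + _ *: _); ring.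
have f2 : test_op t2 *m output U e = output U e by rewrite t2E rs scale0r subr0.
have ve : valid_entry U e.
  split=> //; first by rewrite big_cons big_seq1 /=
    -[RHS](@mulfV _ 2%:R) ?pnatr_eq0 // mulr_natl mulr2n.
  have w0 : 0 < 2^-1 :> C by rewrite invr_gt0 ltr0n.
  move=> t [<-|[<-|[]]]; split=> //; try exact: proj_meas_proj1.
    by rewrite f1.
  by rewrite f2.
exists e; split=> //; apply/(ordinary_entryP hU ve) => z hz; rewrite oE.
have := hz t1 (or_introl erefl); have := hz t2 (or_intror (or_introl erefl)).
rewrite t1E t2E => /eqP; rewrite subr_eq addrC -subr_eq subrr eq_sym.
rewrite scaler_eq0 => /orP[|]; last first.
  have : unit_vec (kronv r s) by rewrite /unit_vec inner_kronv ur us mulr1.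
  by move=> /unit_vec_neq0 /negPf ->.
set m := inner (kronv p q) z; set n := inner (kronv p' q') z => + ez.
rewrite -ez innerDr !innerZr !inner_kronv /r /s !innerBl !innerZl !innerDl.
rewrite up uq up' uq' pp qq pp' qq' !conjCK hc => /eqP rsz.
(* The first test confines [z] to [m pq + n p'q'], and orthogonality to [r s] reads [b m = a n];
   hence the ratio [m / a]. *)
exists (m / a); rewrite scalerDr !scalerA divfK //; congr (_ + _ *: _).
have h1 : h != 0 by rewrite gt_eqF.
apply: (mulIf a0); rewrite mulrAC divfK //; apply: (mulIf h1).
apply/eqP; rewrite -subr_eq0 -oppr_eq0 -[X in _ == X]rsz; apply/eqP; ring.
Qed.

Lemma settings_ge_size U pr : valid_protocol U pr -> (size pr <= settings pr)%N.
Proof.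
rewrite /settings; elim: pr => [|e pr IH] hv; first by rewrite big_nil.
rewrite big_cons /= -add1n leq_add //.
  by apply: (@tests_neq0 _ U); apply: hv; left.
by apply: IH => e' he'; apply: hv; right.
Qed.

(** Every entry has a test, because its weights add up to 1; equality of the totals leaves no room
    for a second one. *)
Lemma settings_eq_size U pr : valid_protocol U pr -> settings pr = size pr ->
  forall e, List.In e pr -> size (tests e) = 1%N.
Proof.
rewrite /settings; elim: pr => [|e pr IH] hv //=; rewrite big_cons => h.
have te : (0 < size (tests e))%N by apply: (@tests_neq0 _ U); apply: hv; left.
have hv' : valid_protocol U pr by move=> e' he'; apply: hv; right.
have := settings_ge_size hv'; rewrite /settings => hs.
have e1 : size (tests e) = 1%N.
  apply/eqP; rewrite eqn_leq te andbT -(leq_add2r (size pr)) add1n -h.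
  by rewrite leq_add2l.
move=> e' [<- //|]; apply: IH => //.
by apply/eqP; rewrite -(eqn_add2l 1%N) -{1}e1 h add1n.
Qed.

(** Spanning is expressed throughout by the vanishing of the orthogonal complement. Fewer than four
    columns leave a nonzero left kernel vector, whose adjoint lies in that complement. *)
Lemma spanning_size (vs : seq 'cV[C]_4) :
  (forall z, (forall v, List.In v vs -> inner z v = 0) -> z = 0) -> (4 <= size vs)%N.
Proof.
move=> h; rewrite leqNgt; apply/negP => lt.
pose B := \matrix_(k < 4, j < size vs) (nth 0 vs j) k 0.
have : (0 < \rank (kermx B))%N.
  by rewrite mxrank_ker subn_gt0; apply: leq_ltn_trans (rank_leq_col _) _.
rewrite lt0n mxrank_eq0 => /rowV0Pn [v /sub_kermxP hv0 v0].
suff z0 : adjmx v = 0 by rewrite -(adjmxK v) z0 adjmx0 eqxx in v0.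
apply: h => w inw; have /(List.In_nth _ _ 0) [n [hn <-]] := inw.
have hn' : (n < size vs)%N by apply/ssrnat.ltP.
rewrite /inner adjmxK mxE; move/rowP/(_ (Ordinal hn')): hv0.
rewrite !mxE => hv0; rewrite -[RHS]hv0.
apply: eq_bigr => k _; rewrite !mxE /=; congr (_ * fun_of_matrix _ k 0).
(* Here [List.nth] is identified with [nth]. *)
by elim: (vs) (n) => [|u us IH] [|m] //=.
Qed.

Lemma settings_ge4 U pr : unitary U -> verifies U pr -> (4 <= size pr)%N.
Proof.
move=> hU hv; rewrite -(size_map (@input C)); apply: spanning_size => z hz.
apply: (verifies_span hU hv) => e he; apply: hz.
exact: List.in_map.
Qed.

End Entries.

(** * Real orthogonal diagonalization of symmetric unitaries *)

Section OrthogonalDiagonalization.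
Variable C : numClosedFieldType.

Definition real_mx m n (A : 'M[C]_(m, n)) := map_mx Num.conj A = A.

Lemma real_mxM m n p (A : 'M[C]_(m, n)) (B : 'M[C]_(n, p)) :
  real_mx A -> real_mx B -> real_mx (A *m B).
Proof. by rewrite /real_mx map_mxM => -> ->. Qed.

Lemma real_adjmx m n (A : 'M[C]_(m, n)) : real_mx A -> adjmx A = A^T.
Proof. by rewrite /adjmx => ->. Qed.

Lemma real_tr m n (A : 'M[C]_(m, n)) : real_mx A -> real_mx A^T.
Proof. by rewrite /real_mx -map_trmx => ->. Qed.

(* The eigenspaces of a symmetric unitary matrix are stable under conjugation. *)
Lemma sym_unitary_real_eigenvector n (M : 'M[C]_n.+1) : M^T = M -> unitary M ->
  exists (x : 'cV[C]_n.+1) l, [/\ real_mx x, unit_vec x & x^T *m M = l *: x^T].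
Proof.
move=> sM uM; have [l /eigenvalueP [v vM v0]] := eigenvalue_closed M (ltn0Sn n).
have nv : inner (adjmx v) (adjmx v) != 0.
  apply: contraNneq v0 => /inner_eq0 h; by rewrite -(adjmxK v) h adjmx0.
have ll : l * l^* = 1.
  apply: (mulIf nv); rewrite mul1r -{2}(inner_unitary (adjmx v) (adjmx v) (unitary_adj uM)).
  by rewrite -adjmxM vM adjmxZ innerZl innerZr conjCK mulrA.
pose c := map_mx Num.conj v.
have cM : c *m M = l *: c.
  have hMc : map_mx Num.conj M = adjmx M by rewrite /adjmx map_trmx sM.
  have : c *m adjmx M = l^* *: c by rewrite -hMc -map_mxM vM map_mxZ.
  move/(congr1 (fun A => A *m M)); rewrite -mulmxA unitaryP // mulmx1 -scalemxAl.
  by move/(congr1 (fun A => l *: A)); rewrite scalerA ll scale1r => <-.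
have cc : map_mx Num.conj c = v by apply/rowP => k; rewrite !mxE conjCK.
have [r [hr r0 rM]] : exists r : 'rV[C]_n.+1, [/\ real_mx r, r != 0 & r *m M = l *: r].
  (* The real part of [v] is a real eigenvector unless it vanishes; in that case [v] is purely
     imaginary and ['i *: v] is real. *)
  have [s0|s0] := eqVneq (v + c) 0.
    exists ('i *: v); split; last by rewrite -scalemxAl vM !scalerA mulrC.
      rewrite /real_mx map_mxZ /= conjCi -/c.
      have -> : c = - v by apply/eqP; rewrite -addr_eq0 addrC s0.
      by rewrite scaleNr scalerN opprK.
    by rewrite scaler_eq0 negb_or neq0Ci.
  exists (v + c); split=> //; last by rewrite mulmxDl vM cM scalerDr.
  by rewrite /real_mx map_mxD cc addrC.
have rT0 : r^T != 0 by rewrite trmx_eq0.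
have [s s0 [_ us]] := unit_normalize rT0.
exists (s^-1 *: r^T), l; split=> //.
  by rewrite /real_mx map_mxZ -map_trmx hr fmorphV /= (CrealP _) ?gtr0_real.
by rewrite linearZ /= trmxK -scalemxAl rM !scalerA mulrC.
Qed.

(** [H] is the reflection in the hyperplane orthogonal to [w = x - e]. It sends [x] to [e] because
    [<x,e>] is real, which gives [<w,w> = 2 <w,x>]. *)
Lemma householder n (x : 'cV[C]_n.+1) : real_mx x -> unit_vec x ->
  exists H : 'M[C]_n.+1, [/\ real_mx H, H^T = H, H *m H = 1%:M &
    H *m x = delta_mx 0 0].
Proof.
move=> rx ux; pose e : 'cV[C]_n.+1 := delta_mx 0 0.
have re : real_mx e by apply/matrixP => i j; rewrite !mxE conjC_nat.
have ue : inner e e = 1.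
  rewrite innerE (bigD1 ord0) //= big1 => [|k k0]; last first.
    by rewrite !mxE (negPf k0) /= mulr0.
  by rewrite !mxE /= conjC1 mulr1 addr0.
have [->|xe] := eqVneq x e.
  exists 1%:M; split; rewrite ?trmx1 ?mulmx1 ?mul1mx //.
  exact: map_mx1.
pose w := x - e; have w0 : w != 0 by rewrite subr_eq0.
have rw : real_mx w by rewrite /real_mx map_mxB rx re.
have nw : inner w w != 0 by apply: contraNneq w0 => /inner_eq0 ->.
have exe : inner x e = inner e x.
  have h : (inner e x)^* = inner e x.
    rewrite innerE rmorph_sum; apply: eq_bigr => k _; rewrite rmorphM /= conjCK.
    have /matrixP/(_ k 0) := rx; have /matrixP/(_ k 0) := re; rewrite !mxE.
    by move=> -> ->.
  by rewrite -h inner_conj.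
have wx : inner w w = 2%:R * inner w x.
  by rewrite /w innerBr !innerBl exe ue ux; ring.
pose c := 2%:R / inner w w.
have rc : c^* = c.
  rewrite /c rmorphM fmorphV /= conjC_nat (CrealP _) //.
  by rewrite ger0_real // inner_ge0.
pose H : 'M[C]_n.+1 := 1%:M - c *: (w *m adjmx w).
have Hx z : H *m z = z - (c * inner w z) *: w.
  by rewrite mulmxBl mul1mx -scalemxAl mul_col_inner scalerA.
have aH : adjmx H = H by rewrite adjmxB adjmx1 adjmxZ adjmxM adjmxK rc.
have rH : real_mx H.
  rewrite /real_mx map_mxB map_mx1 map_mxZ /= rc map_mxM rw.
  by rewrite (real_adjmx rw) (real_tr rw) /H (real_adjmx rw).
exists H; split=> //; first by rewrite -(real_adjmx rH).
  apply: mx_ext => z; rewrite -mulmxA !Hx innerBr innerZr mul1mx.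
  rewrite -addrA -opprD -scalerDl [X in X *: w](_ : _ = 0) ?scale0r ?subr0 //.
  by rewrite /c; field.
have cw : c * inner w x = 1 by rewrite /c mulrAC -wx divff.
by rewrite Hx cw scale1r /w opprB addrC subrK.
Qed.

(** The change of basis has to be real orthogonal, since it must respect transposes as well as
    adjoints. A reflection moves a real eigenvector to the first basis vector; the first row is then
    a multiple of that vector, and symmetry clears the first column too. *)
Lemma sym_unitary_diag n (M : 'M[C]_n) : M^T = M -> unitary M ->
  exists (O : 'M[C]_n) (d : 'rV[C]_n),
    [/\ real_mx O, O *m O^T = 1%:M & O *m M *m O^T = diag_mx d].
Proof.
elim: n M => [|n IH] M sM uM.
  by exists 1%:M, 0; split; [exact: map_mx1 | rewrite trmx1 mulmx1 | apply/matrixP => -[]].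
have [x [l [rx ux xM]]] := sym_unitary_real_eigenvector sM uM.
have [H [rH sH HH Hx]] := householder rx ux.
(* The product is retyped at size [1 + n] so that block decompositions apply. *)
have [M1 M1d] : exists M1 : 'M[C]_(1 + n), M1 = H *m M *m H by eexists.
have sM1 : M1^T = M1 by rewrite M1d !trmx_mul sM sH mulmxA.
have uH : unitary H by rewrite /unitary (real_adjmx rH) sH.
have uM1 : unitary M1 by rewrite M1d; do 2?apply: unitaryM.
have row0 : delta_mx 0 0 *m M1 = l *: delta_mx 0 0 :> 'rV_(1 + n).
  have e0 : (delta_mx 0 0 : 'rV[C]_(1 + n)) = x^T *m H.
    by rewrite -[RHS]trmxK trmx_mul trmxK sH Hx trmx_delta.
  rewrite {1}e0 M1d !mulmxA -[x^T *m H *m H]mulmxA HH mulmx1 xM -scalemxAl.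
  by rewrite -e0.
have M1E j : M1 0 j = l * (j == 0)%:R.
  by have /rowP/(_ j) := row0; rewrite -rowE !mxE eqxx.
have l0 : lshift n 0 = 0 :> 'I_(1 + n) by exact: val_inj.
pose M' := drsubmx M1.
have bM : M1 = block_mx l%:M 0 0 M'.
  rewrite -[LHS]submxK; congr block_mx; apply/matrixP => i j; rewrite !mxE.
  - by rewrite !ord1 l0 M1E !eqxx mulr1.
  - by rewrite !ord1 l0 M1E mulr0.
  - by rewrite !ord1 -sM1 mxE l0 M1E mulr0.
have sM' : M'^T = M' by rewrite /M' trmx_drsub sM1.
have uM' : unitary M'.
  move: uM1; rewrite bM /unitary /adjmx map_block_mx tr_block_mx mulmx_block.
  rewrite -[1%:M](@submxK _ 1 n 1 n) => /eq_block_mx [_ _ _].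
  rewrite !map_mx0 trmx0 mul0mx add0r => ->.
  by apply/matrixP => i j; rewrite !mxE.
have [O' [d' [rO' oO' dO']]] := IH M' sM' uM'.
pose B : 'M[C]_(1 + n) := block_mx 1%:M 0 0 O'.
have BT : B^T = block_mx 1%:M 0 0 O'^T by rewrite tr_block_mx trmx1 !trmx0.
have rB : real_mx B by rewrite /real_mx map_block_mx !map_mx0 rO' map_mx1.
have BB : B *m B^T = 1%:M.
  rewrite BT mulmx_block !mulmx0 !mul0mx !addr0 !add0r mulmx1 oO'.
  by rewrite -scalar_mx_block.
have BM : B *m M1 *m B^T = diag_mx (row_mx (const_mx l : 'rV_1) d').
  rewrite bM BT !mulmx_block !mulmx0 !mul0mx !addr0 !add0r !mulmx1 !mul1mx.
  by rewrite dO' diag_mx_row diag_const_mx ?mul0mx ?addr0.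
exists (B *m H), (row_mx (const_mx l : 'rV_1) d' : 'rV_(1 + n)); split.
- exact: real_mxM.
- by rewrite trmx_mul sH mulmxA -(mulmxA B) HH mulmx1.
by rewrite -BM M1d trmx_mul sH !mulmxA.
Qed.

End OrthogonalDiagonalization.

(** * Isometries of the determinant form *)

Definition o0 : 'I_4 := @Ordinal 4 0 isT.
Definition o1 : 'I_4 := @Ordinal 4 1 isT.
Definition o2 : 'I_4 := @Ordinal 4 2 isT.
Definition o3 : 'I_4 := @Ordinal 4 3 isT.

Lemma sum4 (V : nmodType) (F : 'I_4 -> V) :
  \sum_k F k = F o0 + F o1 + F o2 + F o3.
Proof.
rewrite !big_ord_recl big_ord0 addr0 !addrA.
by congr (F _ + F _ + F _ + F _); apply: val_inj.
Qed.

Lemma ord4P (P : 'I_4 -> Prop) : P o0 -> P o1 -> P o2 -> P o3 -> forall k, P k.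
Proof.
move=> h0 h1 h2 h3 [[|[|[|[|k]]]] hk] //.
- by rewrite (_ : Ordinal hk = o0) //; apply: val_inj.
- by rewrite (_ : Ordinal hk = o1) //; apply: val_inj.
- by rewrite (_ : Ordinal hk = o2) //; apply: val_inj.
- by rewrite (_ : Ordinal hk = o3) //; apply: val_inj.
Qed.

Lemma ord2P (P : 'I_2 -> Prop) : P 0 -> P 1 -> forall k, P k.
Proof.
move=> h0 h1 [[|[|k]] hk] //.
- by rewrite (_ : Ordinal hk = 0) //; apply: val_inj.
- by rewrite (_ : Ordinal hk = 1) //; apply: val_inj.
Qed.

Lemma sum2 (V : nmodType) (F : 'I_2 -> V) : \sum_k F k = F 0 + F 1.
Proof.
rewrite !big_ord_recl big_ord0 addr0.
by congr (F _ + F _); apply: val_inj.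
Qed.

Lemma qidxE : (qidx 0 0 = o0) * (qidx 0 1 = o1) * (qidx 1 0 = o2) * (qidx 1 1 = o3).
Proof. by do !split; apply: val_inj; rewrite /= inordK. Qed.

Lemma qfstE : (qfst o0 = 0) * (qfst o1 = 0) * (qfst o2 = 1) * (qfst o3 = 1).
Proof. by do !split; apply: val_inj; rewrite /= inordK. Qed.

Lemma qsndE : (qsnd o0 = 0) * (qsnd o1 = 1) * (qsnd o2 = 0) * (qsnd o3 = 1).
Proof. by do !split; apply: val_inj; rewrite /= inordK. Qed.

Section Magic.
Variable C : numClosedFieldType.
Implicit Types (z phi : 'cV[C]_4) (x y : 'cV[C]_2).

(** The determinant of the 2x2 amplitude matrix of [z], a quadratic form whose zeros are the product
    vectors ([qf_kronv], [qf_product]). *)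
Definition qf z := z o0 0 * z o3 0 - z o1 0 * z o2 0.
Definition wedge x y := x 0 0 * y 1 0 - x 1 0 * y 0 0.
Definition col2 (a b : C) : 'cV[C]_2 := \col_i (if i == 0 then a else b).
Definition cols2 x y : 'M[C]_2 := \matrix_(i, j) (if j == 0 then x i 0 else y i 0).
Definition ev (a : 'I_2) : 'cV[C]_2 := delta_mx a 0.

Lemma qf_kronv x y : qf (kronv x y) = 0.
Proof. by rewrite /qf !mxE !qfstE !qsndE; ring. Qed.

Lemma det2 (A : 'M[C]_2) : \det A = A 0 0 * A 1 1 - A 0 1 * A 1 0.
Proof.
have e0 : lift (0 : 'I_2) (0 : 'I_1) = 1 by exact: val_inj.
have e1 : lift (1 : 'I_2) (0 : 'I_1) = 0 by exact: val_inj.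
rewrite (expand_det_row _ 0) sum2 /cofactor !det_mx11 !mxE e0 e1 expr0 expr1.
by rewrite mul1r mulN1r mulrN.
Qed.

Lemma qf_kron2 (A B : 'M[C]_2) z : qf (kron2 A B *m z) = \det A * \det B * qf z.
Proof.
rewrite /qf !mxE !sum4 !mxE !qfstE !qsndE !det2; ring.
Qed.

Lemma qf_product z : qf z = 0 -> exists x y : 'cV[C]_2, z = kronv x y.
Proof.
move=> /eqP; rewrite subr_eq0 => /eqP h.
have [z0|z0] := eqVneq (z o0 0) 0; last first.
  exists (col2 1 (z o2 0 / z o0 0)), (col2 (z o0 0) (z o1 0)).
  apply/colP; apply: ord4P; rewrite !mxE !qfstE !qsndE /= ?mul1r ?divfK //.
  by apply: (mulfI z0); rewrite h; field.
move: h; rewrite z0 mul0r => /esym/eqP; rewrite mulf_eq0 => /orP[] /eqP h.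
  exists (col2 0 1), (col2 (z o2 0) (z o3 0)).
  by apply/colP; apply: ord4P; rewrite !mxE !qfstE !qsndE /= ?mul1r ?mul0r.
exists (col2 (z o1 0) (z o3 0)), (col2 0 1).
by apply/colP; apply: ord4P; rewrite !mxE !qfstE !qsndE /= ?mulr1 ?mulr0.
Qed.

(** [qf] vanishes on each summand, so the left side is the polar form of two product vectors. Its
    factors vanish exactly on parallel tensor factors. *)
Lemma qf_polar x y x' y' : qf (kronv x y + kronv x' y') = wedge x x' * wedge y y'.
Proof. by rewrite /qf /wedge !mxE !qfstE !qsndE; ring. Qed.

Lemma wedge_col x y : x != 0 -> wedge x y = 0 -> exists k, y = k *: x.
Proof.
move=> x0 /eqP; rewrite subr_eq0 => /eqP h.
have [x00|x00] := eqVneq (x 0 0) 0.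
  have x10 : x 1 0 != 0.
    by apply: contraNneq x0 => x10; apply/eqP/colP; apply: ord2P; rewrite mxE.
  exists (y 1 0 / x 1 0); apply/colP; apply: ord2P; rewrite !mxE ?divfK //.
  by apply: (mulfI x10); rewrite -h x00; ring.
exists (y 0 0 / x 0 0); apply/colP; apply: ord2P; rewrite !mxE ?divfK //.
by apply: (mulfI x00); rewrite h; field.
Qed.

Lemma kronv_ev a b : kronv (ev a) (ev b) = delta_mx (qidx a b) 0.
Proof.
apply/colP => k; rewrite !mxE -{3}(qidx_eta k) qidx_eq !eqxx !andbT.
by do 2!case: (_ == _); rewrite ?mulr1 ?mulr0.
Qed.

Lemma mx_ext_kronv (A B : 'M[C]_4) :
  (forall a b, A *m kronv (ev a) (ev b) = B *m kronv (ev a) (ev b)) -> A = B.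
Proof.
move=> h; apply/matrixP => i j; have /colP/(_ i) := h (qfst j) (qsnd j).
by rewrite kronv_ev qidx_eta -!colE !mxE.
Qed.

Definition swapmx : 'M[C]_4 := \matrix_(i, j) (i == qidx (qsnd j) (qfst j))%:R.

Lemma swap_kronv x y : swapmx *m kronv x y = kronv y x.
Proof.
apply/colP; apply: ord4P; rewrite !mxE !sum4 !mxE !qfstE !qsndE !qidxE /=; ring.
Qed.

Lemma swap_kron2 (A B : 'M[C]_2) : swapmx *m kron2 A B = kron2 B A *m swapmx.
Proof.
apply: mx_ext_kronv => a b.
by rewrite -!mulmxA kron2_kronv !swap_kronv kron2_kronv.
Qed.

Lemma cols2_ev x y : (cols2 x y *m ev 0 = x) * (cols2 x y *m ev 1 = y).
Proof. by split; rewrite -colE; apply/colP => k; rewrite !mxE. Qed.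

(* [W] maps the four basis vectors to product vectors; their polar form decides
   which factors are parallel, with or without exchange of the two qubits. *)
Lemma qf_isometry_local (W : 'M[C]_4) : (forall z, qf (W *m z) = qf z) ->
  (exists A B, W = kron2 A B) \/ (exists A B, W = kron2 A B *m swapmx).
Proof.
move=> hW.
have prod a b : exists xy : 'cV[C]_2 * 'cV[C]_2,
    W *m kronv (ev a) (ev b) = kronv xy.1 xy.2.
  by have [|x [y h]] := @qf_product (W *m kronv (ev a) (ev b));
     [rewrite hW qf_kronv | exists (x, y)].
have [[x00 y00] /= h00] := prod 0 0; have [[x01 y01] /= h01] := prod 0 1.
have [[x10 y10] /= h10] := prod 1 0; have [[x11 y11] /= h11] := prod 1 1.
have pol a b a' b' x y x' y' : W *m kronv (ev a) (ev b) = kronv x y ->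
    W *m kronv (ev a') (ev b') = kronv x' y' ->
    wedge x x' * wedge y y' = wedge (ev a) (ev a') * wedge (ev b) (ev b').
  by move=> h h'; rewrite -qf_polar -h -h' -mulmxDr hW qf_polar.
have e01 : wedge (ev 0) (ev 1) = 1 by rewrite /wedge !mxE /= mulr1 mul0r subr0.
have e10 : wedge (ev 1) (ev 0) = -1 by rewrite /wedge !mxE /= mul0r mul1r sub0r.
have e00 a : wedge (ev a) (ev a) = 0 by rewrite /wedge mulrC subrr.
have p1 := pol _ _ _ _ _ _ _ _ h00 h11; rewrite !e01 mulr1 in p1.
have p2 := pol _ _ _ _ _ _ _ _ h01 h10; rewrite e01 e10 mul1r in p2.
have p3 := pol _ _ _ _ _ _ _ _ h00 h01; rewrite e00 mul0r in p3.
have p4 := pol _ _ _ _ _ _ _ _ h11 h01; rewrite e00 mulr0 in p4.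
have p5 := pol _ _ _ _ _ _ _ _ h00 h10; rewrite e00 mulr0 in p5.
have p6 := pol _ _ _ _ _ _ _ _ h11 h10; rewrite e00 mul0r in p6.
have wx : wedge x00 x11 != 0.
  by apply: contra_eq_neq p1 => ->; rewrite mul0r eq_sym oner_eq0.
have wy : wedge y00 y11 != 0.
  by apply: contra_eq_neq p1 => ->; rewrite mulr0 eq_sym oner_eq0.
have w0l x : wedge 0 x = 0 by rewrite /wedge !mxE; ring.
have w0r x : wedge x 0 = 0 by rewrite /wedge !mxE; ring.
have wZr k x y : wedge x (k *: y) = k * wedge x y by rewrite /wedge !mxE; ring.
have wZl k x y : wedge (k *: x) y = k * wedge x y by rewrite /wedge !mxE; ring.
have wC x y : wedge x y = - wedge y x by rewrite /wedge; ring.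
have x00n : x00 != 0 by apply: contraNneq wx => ->; rewrite w0l.
have x11n : x11 != 0 by apply: contraNneq wx => ->; rewrite w0r.
have y00n : y00 != 0 by apply: contraNneq wy => ->; rewrite w0l.
have y11n : y11 != 0 by apply: contraNneq wy => ->; rewrite w0r.
(* Vanishing of both products leaves four cases. One condition on [x] and one on [y] give the two
   listed vectors; two conditions on the same factor force it to be 0. *)
have mid x y : wedge x00 x * wedge y00 y = 0 -> wedge x11 x * wedge y11 y = 0 ->
    exists k, kronv x y = k *: kronv x00 y11 \/ kronv x y = k *: kronv x11 y00.
  move=> /eqP + /eqP; rewrite !mulf_eq0 => /orP[] /eqP a /orP[] /eqP b.
  - have [k xk] := wedge_col x00n a; exists 0; left; rewrite scale0r xk.
    move: b; rewrite xk wZr wC => /eqP; rewrite mulf_eq0 oppr_eq0 (negPf wx) orbF.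
    by move=> /eqP ->; rewrite kronvZl !scale0r.
  - have [k ->] := wedge_col x00n a; have [k' ->] := wedge_col y11n b.
    by exists (k * k'); left; rewrite kronvZl kronvZr scalerA.
  - have [k ->] := wedge_col x11n b; have [k' ->] := wedge_col y00n a.
    by exists (k * k'); right; rewrite kronvZl kronvZr scalerA.
  - have [k yk] := wedge_col y00n a; exists 0; left; rewrite scale0r yk.
    move: b; rewrite yk wZr wC => /eqP; rewrite mulf_eq0 oppr_eq0 (negPf wy) orbF.
    by move=> /eqP ->; rewrite kronvZr !scale0r.
(* If the images of [01] and [10] were multiples of the same vector, their polar form would be 0
   instead of -1. The other two combinations are a local map without and with a swap. *)
have [k [] hk] := mid _ _ p3 p4; have [l [] hl] := mid _ _ p5 p6;
  rewrite hk -kronvZl in h01; rewrite hl -kronvZl in h10;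
  have := pol _ _ _ _ _ _ _ _ h01 h10; rewrite !wZl !wZr e01 e10.
- have -> : wedge x00 x00 = 0 by rewrite /wedge mulrC subrr.
  by move=> /eqP; rewrite !mulr0 !mul0r eq_sym mul1r oppr_eq0 oner_eq0.
- move=> kl; have {}kl : k * l = 1.
    transitivity (k * l * (wedge x00 x11 * wedge y00 y11)); first by rewrite p1 mulr1.
    by apply: oppr_inj; rewrite -[RHS]mul1r -kl (wC y11); ring.
  (* The scalars [l] and [k] are put on the second columns of the two factors; the image of [11]
     then comes out right because [k l = 1]. *)
  left; exists (cols2 x00 (l *: x11)), (cols2 y00 (k *: y11)).
  apply: mx_ext_kronv; apply: ord2P; apply: ord2P;
    rewrite kron2_kronv !cols2_ev ?h00 ?h01 ?h10 ?h11 //.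
    by rewrite kronvZl kronvZr.
  by rewrite kronvZl kronvZr scalerA mulrC kl scale1r.
- move=> kl; have {}kl : k * l = 1.
    transitivity (k * l * (wedge x00 x11 * wedge y00 y11)); first by rewrite p1 mulr1.
    by apply: oppr_inj; rewrite -[RHS]mul1r -kl (wC x11); ring.
  right; exists (cols2 x00 (k *: x11)), (cols2 y00 (l *: y11)).
  apply: mx_ext_kronv; apply: ord2P; apply: ord2P;
    rewrite -mulmxA swap_kronv kron2_kronv !cols2_ev ?h00 ?h01 ?h10 ?h11 //.
    by rewrite kronvZl kronvZr.
  by rewrite kronvZl kronvZr scalerA kl scale1r.
have -> : wedge x11 x11 = 0 by rewrite /wedge mulrC subrr.
by move=> /eqP; rewrite !mulr0 !mul0r eq_sym mul1r oppr_eq0 oner_eq0.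
Qed.

End Magic.

(** * Magic basis and canonical decomposition *)

Section KAK.
Variable C : numClosedFieldType.
Implicit Types (z phi : 'cV[C]_4).

Definition h2 : C := sqrtC 2^-1.

Lemma h2_gt0 : 0 < h2.
Proof. by rewrite sqrtC_gt0 invr_gt0 ltr0n. Qed.

Lemma h2_conj : h2^* = h2.
Proof. by rewrite (CrealP _) // gtr0_real ?h2_gt0. Qed.

Lemma h2h2 : h2 * h2 = 2^-1.
Proof. by rewrite -expr2 sqrtCK. Qed.

Lemma ii : 'i * 'i = -1 :> C.
Proof. by rewrite -expr2 sqrCi. Qed.

(** The columns are the Bell states [Phi+], [i Phi-], [i Psi+], [Psi-]; the factors [i] make all
    four squares enter [qf] with the same sign. *)
Definition magic : 'M[C]_4 := \matrix_(i, j)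
  nth 0 (nth [::] [:: [:: h2; 'i * h2; 0; 0];
                      [:: 0; 0; 'i * h2; h2];
                      [:: 0; 0; 'i * h2; - h2];
                      [:: h2; - 'i * h2; 0; 0]] i) j.

Lemma half2 : 2^-1 + 2^-1 = 1 :> C.
Proof. by field. Qed.

Lemma magic_unitary : unitary magic.
Proof.
(* [ring] treats ['i] as a variable, so the relations that use ['i * 'i = -1] are prepared by
   hand. *)
have hE : h2 * h2 - 'i * 'i * (h2 * h2) = 1.
  by rewrite ii h2h2 mulN1r opprK half2.
have h0 : h2 * h2 + 'i * 'i * (h2 * h2) = 0 by rewrite ii mulN1r subrr.
apply/matrixP; apply: ord4P; apply: ord4P; rewrite !mxE !sum4 !mxE /=;
  rewrite ?mulNr ?rmorphN ?rmorphM /= ?conjC0 ?h2_conj ?conjCi -?[RHS]hE.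
all: try (by ring).
all: first [by rewrite -[RHS]h0; ring | by rewrite -[RHS]oppr0 -[X in _ = - X]h0; ring].
Qed.

(** The complex bilinear sum of squares, without conjugation; it is the form that orthogonal
    matrices preserve. *)
Definition sq n (phi : 'cV[C]_n) := \sum_k phi k 0 ^+ 2.

Lemma sqE n (phi : 'cV[C]_n) : sq phi = (phi^T *m phi) 0 0.
Proof. by rewrite mxE; apply: eq_bigr => k _; rewrite mxE expr2. Qed.

Lemma qf_magic phi : qf (magic *m phi) = 2^-1 * sq phi.
Proof.
rewrite /qf /sq !mxE !sum4 !mxE /= -h2h2.
transitivity (h2 * h2 * (phi o0 0 ^+ 2 - ('i * 'i) * phi o1 0 ^+ 2
  - ('i * 'i) * phi o2 0 ^+ 2 + phi o3 0 ^+ 2)); first by ring.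
by rewrite ii; ring.
Qed.

Definition magic_diag (l : 'rV[C]_4) : 'M[C]_4 := magic *m diag_mx l *m adjmx magic.

(** The singlet, at index [o3], is the only antisymmetric magic vector. A swap can thus be absorbed
    into the diagonal part. *)
Lemma swap_magic_diag : swapmx C =
  magic_diag (\row_k (if k == o3 then -1 else 1)).
Proof.
rewrite /magic_diag; have -> : magic *m diag_mx (\row_k (if k == o3 then -1 else 1))
    = swapmx C *m magic.
  apply/matrixP; apply: ord4P; apply: ord4P;
    rewrite !mxE !sum4 !mxE ?qfstE ?qsndE ?qidxE /=; ring.
by rewrite -mulmxA magic_unitary mulmx1.
Qed.

Lemma magic_diagM l m :
  magic_diag l *m magic_diag m = magic_diag (\row_k (l 0 k * m 0 k)).
Proof.
rewrite /magic_diag -mulmxA !(mulmxA (adjmx magic)) unitaryP ?mul1mx; last exact: magic_unitary.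
rewrite !mulmxA; congr (_ *m _); rewrite -!mulmxA; congr (_ *m _).
apply/matrixP => i j; rewrite mul_diag_mx !mxE.
by case: eqP => [->|]; rewrite ?mulr1n ?mulr0n ?mulr0.
Qed.

(** Both [A *m adjmx A] and [B *m adjmx B] must be scalar, with inverse positive scalars [x] and
    [x^-1]; rescaling by the square root of [x] makes both factors unitary. *)
Lemma kron2_unitary_factors (A B : 'M[C]_2) : unitary (kron2 A B) ->
  exists A' B', [/\ unitary A', unitary B' & kron2 A B = kron2 A' B'].
Proof.
rewrite /unitary kron2_adj kron2M; set X := A *m _; set Y := B *m _ => hXY.
have XY a a' b b' : X a a' * Y b b' = ((a == a') && (b == b'))%:R.
  have /matrixP/(_ (qidx a b) (qidx a' b')) := hXY.
  by rewrite !mxE !qidxK1 !qidxK2 qidx_eq.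
have X0 : X 0 0 != 0.
  by apply: contra_eq_neq (XY 0 0 0 0) => /= ->; rewrite mul0r eq_sym oner_eq0.
have Y0 : Y 0 0 != 0.
  by apply: contra_eq_neq (XY 0 0 0 0) => /= ->; rewrite mulr0 eq_sym oner_eq0.
have hx : 0 < X 0 0.
  rewrite lt_def X0 /X mxE sumr_ge0 // => k _; rewrite !mxE.
  by rewrite -normCK exprn_ge0.
set x := X 0 0 in X0 hx.
have y0 : Y 0 0 = x^-1.
  by apply: (mulfI X0); rewrite divff //; exact: XY.
have XE : X = x%:M.
  apply/matrixP => a a'; rewrite [RHS]mxE; apply: (mulIf Y0).
  rewrite (XY a a' 0 0) y0 eqxx andbT.
  by case: (_ == _); rewrite ?mulr1n ?mulr0n ?mul0r ?divff.
have YE : Y = x^-1%:M.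
  apply/matrixP => b b'; rewrite [RHS]mxE; apply: (mulfI X0); rewrite (XY 0 0 b b') eqxx /=.
  by case: (_ == _); rewrite ?mulr1n ?mulr0n ?mulr0 ?divff.
have r0 : 0 < sqrtC x by rewrite sqrtC_gt0.
have rc : (sqrtC x)^* = sqrtC x by rewrite (CrealP _) // gtr0_real.
exists ((sqrtC x)^-1 *: A), (sqrtC x *: B); split.
- rewrite adjmxZ -scalemxAl -scalemxAr -/X XE fmorphV /= rc scalerA scale_scalar_mx.
  by rewrite -[X in _ * X]sqrtCK; congr (_%:M); field; rewrite gt_eqF.
- rewrite adjmxZ -scalemxAl -scalemxAr -/Y YE rc scalerA scale_scalar_mx.
  by rewrite -expr2 sqrtCK divff.
apply/matrixP => i j; rewrite !mxE; field; by rewrite gt_eqF.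
Qed.

(** Conjugated by the magic basis, [O] preserves [qf], so it is local up to a swap. The signs [s]
    encode that swap; moving it to the left exchanges the two factors, hence the alternative. *)
Lemma magic_orthogonal_local (O : 'M[C]_4) : unitary O -> O^T *m O = 1%:M ->
  exists A B (s : 'rV[C]_4), [/\ unitary A, unitary B, (forall k, s 0 k * s 0 k = 1),
    magic *m O *m adjmx magic = kron2 A B *m magic_diag s &
    magic *m O *m adjmx magic = magic_diag s *m kron2 B A \/
    magic *m O *m adjmx magic = magic_diag s *m kron2 A B].
Proof.
move=> uO OO; set W := _ *m adjmx _.
have uW : unitary W.
  by do 2?apply: unitaryM => //; [apply: magic_unitary | apply/unitary_adj/magic_unitary].
have hW z : qf (W *m z) = qf z.
  rewrite /W -!mulmxA qf_magic -{2}[z]mul1mx -magic_unitary -[in RHS]mulmxA qf_magic.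
  by rewrite !sqE trmx_mul !mulmxA -(mulmxA _ O^T) OO mulmx1.
have m1 : magic_diag (const_mx 1) = 1%:M.
  by rewrite /magic_diag diag_const_mx mulmx1 magic_unitary.
case: (qf_isometry_local hW) => [] [A [B WE]].
  have [|A' [B' [uA uB AB]]] := @kron2_unitary_factors A B; first by rewrite -WE.
  exists A', B', (const_mx 1); split=> //; rewrite ?m1 ?mulmx1 ?mul1mx -?AB //.
    by move=> k; rewrite !mxE mulr1.
  by right.
have SS : swapmx C *m swapmx C = 1%:M.
  by apply: mx_ext_kronv => a b; rewrite -mulmxA !swap_kronv mul1mx.
have [|A' [B' [uA uB AB]]] := @kron2_unitary_factors A B.
  have -> : kron2 A B = W *m swapmx C by rewrite WE -mulmxA SS mulmx1.
  apply: unitaryM => //; rewrite /unitary; have -> : adjmx (swapmx C) = swapmx C; last by [].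
  by apply/matrixP; apply: ord4P; apply: ord4P; rewrite 
    !mxE ?qfstE ?qsndE ?qidxE /= ?conjC0 ?conjC1.
exists A', B', (\row_k (if k == o3 then -1 else 1)); split=> //.
- by move=> k; rewrite !mxE; case: ifP; rewrite ?mulrNN mulr1.
- by rewrite -swap_magic_diag -AB.
by left; rewrite -swap_magic_diag swap_kron2 -AB.
Qed.

(** If [V = P diag(l) O] with orthogonal [P] and [O], then [V^T V = O^T diag(l^2) O]. So [O] and [l]
    are read off from the symmetric unitary [V^T V], and [P] is then determined; it comes out
    unitary and orthogonal. *)
Lemma kak (U : 'M[C]_4) : unitary U ->
  exists A B A' B' (l : 'rV[C]_4), [/\ unitary A /\ unitary B, unitary A' /\ unitary B',
    (forall k, l 0 k * (l 0 k)^* = 1) &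
    U = kron2 A B *m magic_diag l *m kron2 A' B'].
Proof.
move=> uU; have uQ := magic_unitary.
pose V := adjmx magic *m U *m magic.
have uV : unitary V by do 2?apply: unitaryM => //; exact: unitary_adj.
have UV : U = magic *m V *m adjmx magic.
  by rewrite /V !mulmxA uQ mul1mx -!mulmxA uQ mulmx1.
have tr_unitary n (X : 'M[C]_n) : unitary X -> unitary X^T.
  move=> /unitaryP h; rewrite /unitary /adjmx map_trmx trmxK.
  by rewrite -[LHS]trmxK trmx_mul trmxK h trmx1.
pose M := V^T *m V.
have sM : M^T = M by rewrite trmx_mul trmxK.
have uM : unitary M by apply: unitaryM => //; exact: tr_unitary.
have [O [d [rO OO OM]]] := sym_unitary_diag sM uM.
have uO : unitary O by rewrite /unitary real_adjmx.
have OTO : O^T *m O = 1%:M by rewrite mulmx1C.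
have ud : unitary (diag_mx d).
  by rewrite -OM; do 2?apply: unitaryM => //; exact: tr_unitary.
have nd k : d 0 k * (d 0 k)^* = 1.
  have /matrixP/(_ k k) := ud; rewrite mul_diag_mx !mxE eqxx.
  by rewrite !mulr1n.
(* Any choice of roots would do: another sign of [l_k] only changes the sign of a column of [P]. *)
pose l : 'rV[C]_4 := \row_k sqrtC (d 0 k).
have ld k : l 0 k * l 0 k = d 0 k by rewrite mxE -expr2 sqrtCK.
have nl k : l 0 k * (l 0 k)^* = 1.
  have : (l 0 k * (l 0 k)^*) ^+ 2 = 1.
    by rewrite -(nd k) -ld rmorphM /=; ring.
  move/eqP; rewrite sqrf_eq1 => /orP[/eqP //|/eqP h].
  by have := exprn_ge0 2 (normr_ge0 (l 0 k)); rewrite normCK h oppr_ge0 ler10.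
have lU k : l 0 k != 0.
  by apply: contra_eq_neq (nl k) => ->; rewrite mul0r eq_sym oner_eq0.
pose P := V *m O^T *m diag_mx (map_mx GRing.inv l).
have dl : diag_mx (map_mx GRing.inv l) *m diag_mx l = 1%:M.
  apply/matrixP => i j; rewrite mul_diag_mx !mxE.
  case: eqP => [->|]; rewrite ?mulr1n ?mulr0n ?mulr0 //.
  by have := lU j; rewrite mxE => /mulVf.
have VP : V = P *m diag_mx l *m O.
  by rewrite /P -(mulmxA (V *m O^T)) dl mulmx1 -mulmxA OTO mulmx1.
have uP : unitary P.
  do 2?apply: unitaryM => //; first exact: tr_unitary.
  apply/matrixP => i j; rewrite mul_diag_mx !mxE eq_sym.
  case: eqP => [->|]; rewrite ?mulr1n ?mulr0n ?conjC0 ?mulr0 //.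
  by rewrite fmorphV /= -invfM; have := nl j; rewrite !mxE => ->; rewrite invr1.
have PP : P^T *m P = 1%:M.
  rewrite /P (trmx_mul (V *m _)) (trmx_mul V) trmxK tr_diag_mx.
  set L := diag_mx _; transitivity (L *m (O *m M *m O^T) *m L).
    by rewrite /M !mulmxA.
  rewrite OM /L.
  apply/matrixP => i j; rewrite -mulmxA mul_diag_mx mul_mx_diag !mxE.
  case: eqP => [->|]; rewrite ?mulr1n ?mulr0n ?mul0r ?mulr0 //.
  have := lU j; rewrite mxE; set t := sqrtC _ => t0.
  by transitivity (t^-1 * (t ^+ 2 / t)); [rewrite sqrtCK | field].
have [A [B [s [uA uB ss PE _]]]] := magic_orthogonal_local uP PP.
have [A2 [B2 [s2 [uA2 uB2 ss2 _ OE]]]] := magic_orthogonal_local uO OTO.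
have [A' [B' [uA' uB' {}OE]]] : exists A' B', [/\ unitary A', unitary B' &
    magic *m O *m adjmx magic = magic_diag s2 *m kron2 A' B'].
  by case: OE => h; [exists B2, A2 | exists A2, B2].
(* The signs left by swaps in the two outer factors are merged into the diagonal; this does not
   affect the squares of its entries. *)
exists A, B, A', B', (\row_k (s 0 k * l 0 k * s2 0 k)); split=> //.
  move=> k; rewrite mxE !rmorphM /=.
  have s1 (t : C) : t * t = 1 -> t^* = t.
    move=> h; have : t ^+ 2 == 1 by rewrite expr2 h.
    by rewrite sqrf_eq1 => /orP[] /eqP ->; rewrite ?rmorphN1 ?conjC1.
  rewrite (s1 _ (ss k)) (s1 _ (ss2 k)).
  transitivity (s 0 k * s 0 k * (s2 0 k * s2 0 k) * (l 0 k * (l 0 k)^*)); first by ring.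
  by rewrite ss ss2 nl !mulr1.
have -> : U = (magic *m P *m adjmx magic) *m magic_diag l *m (magic *m O *m adjmx magic).
  rewrite UV VP /magic_diag -!mulmxA !(mulmxA (adjmx magic) magic) (unitaryP uQ).
  by rewrite !mul1mx.
rewrite PE OE.
transitivity (kron2 A B *m (magic_diag s *m magic_diag l *m magic_diag s2) *m kron2 A' B').
  by rewrite !mulmxA.
rewrite !magic_diagM; congr (_ *m magic_diag _ *m _).
by apply/rowP => k; rewrite !mxE.
Qed.

End KAK.

(** * Schmidt coefficients *)

Section Schmidt.
Variable C : numClosedFieldType.

(** The condition on the Schmidt coefficients, freed from their ordering and applied to squares, so
    that it can be carried along a permutation. *)
Definition dominated (f : 'I_4 -> C) :=
  exists j t, [/\ 0 < t, t < f j & forall k, k != j -> f k = t].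

Definition three_equal (d : 'I_4 -> C) :=
  exists k b, d k != b /\ forall j, j != k -> d j = b.

Lemma dominated_perm (f g : 'I_4 -> C) :
  perm_eq [seq f i | i <- enum 'I_4] [seq g i | i <- enum 'I_4] ->
  dominated f -> dominated g.
Proof.
move=> h [j [t [t0 tj ft]]].
have {h}/tuple_permP [p hp] : perm_eq [tuple g i | i < 4] [tuple f i | i < 4].
  by rewrite /= perm_sym.
have gf i : g i = f (p i).
  have := congr1 (fun s => nth 0 s i) hp.
  by rewrite -!tnth_nth !tnth_mktuple.
exists (p^-1%g j), t; split=> //; first by rewrite gf permKV.
move=> k kj; rewrite gf; apply: ft; apply: contraNneq kj => <-.
by rewrite permK.
Qed.

Lemma sorted_dominated (s0 s1 s2 s3 : C) : 0 <= s3 ->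
  s1 <= s0 -> s2 <= s1 -> s3 <= s2 ->
  (s1 < s0 /\ s1 = s2 /\ s2 = s3 /\ 0 < s3) <->
  dominated (fun i : 'I_4 => `|nth 0 [:: s0; s1; s2; s3] i| ^+ 2).
Proof.
move=> h3 h10 h21 h32.
have h2 : 0 <= s2 by apply: le_trans h32.
have h1 : 0 <= s1 by apply: le_trans h21.
have h0 : 0 <= s0 by apply: le_trans h10.
have sq_inj (x y : C) : 0 <= x -> 0 <= y -> x ^+ 2 = y ^+ 2 -> x = y.
  by move=> x0 y0 /eqP; rewrite eqrXn2 // => /eqP.
split=> [[lt [e12 [e23 p]]]|[j [t [t0 tj ht]]]].
  exists o0, (s3 ^+ 2); split; rewrite ?exprn_gt0 //=.
    by rewrite ger0_norm // ltrXn2r // -e23 -e12.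
  by apply: ord4P => //= _; rewrite ger0_norm // ?e12 ?e23.
(* Otherwise [s0^2] would be the common smaller value [t], below the square of a coefficient that is
   at most [s0]. *)
have j0 : j = o0.
  apply/eqP/negPn/negP => nj; have := ht o0; rewrite eq_sym nj /= ger0_norm // => /(_ isT) e0.
  suff : s0 ^+ 2 < s0 ^+ 2 by rewrite ltxx.
  rewrite {1}e0; apply: (lt_le_trans tj); rewrite lerXn2r ?nnegrE ?normr_ge0 //.
  move: j {tj ht nj}; apply: ord4P; rewrite /= ger0_norm //.
    exact: le_trans h10.
  by apply: le_trans h10; exact: le_trans h21.
rewrite j0 /= in tj ht; rewrite ger0_norm // in tj.
have e1 := ht o1 isT; have e2 := ht o2 isT; have e3 := ht o3 isT.
rewrite /= ger0_norm // in e1; rewrite /= ger0_norm // in e2; rewrite /= ger0_norm // in e3.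
have e12 : s1 = s2 by apply: sq_inj; rewrite // e1.
have e23 : s2 = s3 by apply: sq_inj; rewrite // e2.
split; first by rewrite lt_neqAle h10 andbT; apply: contraTneq tj => <-; rewrite e1 ltxx.
do 2!split=> //; rewrite lt_def h3 andbT; apply: contraTneq t0 => s30.
by rewrite -e3 s30 expr0n ltxx.
Qed.

Lemma char_poly_unitary_conj n (V D : 'M[C]_n) : unitary V ->
  char_poly (V *m D *m adjmx V) = char_poly D.
Proof.
move=> uV; rewrite /char_poly.
have -> : char_poly_mx (V *m D *m adjmx V) =
    map_mx polyC V *m char_poly_mx D *m map_mx polyC (adjmx V).
  rewrite /char_poly_mx mulmxBr mulmxBl -!map_mxM; congr (_ - _).
  by rewrite scalar_mxC -mulmxA -map_mxM uV map_mx1 mulmx1.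
rewrite !det_mulmx mulrAC -det_mulmx -map_mxM uV map_mx1 det1 mul1r //.
Qed.

(** Reshaped with rows [(a,a')] and columns [(b,b')], the sum is a matrix [R = V S W^T], and
    [R *m adjmx R] is unitarily similar to the diagonal matrix of the [|s_i|^2]. Its characteristic
    polynomial determines these as a multiset. Complex coefficients are allowed because those of the
    Pauli expansion are complex. *)
Lemma schmidt_unique (s c : 'I_4 -> C) (v w v' w' : 'I_4 -> 'I_2 -> 'I_2 -> C) :
  orthonormal4 v -> orthonormal4 w -> orthonormal4 v' -> orthonormal4 w' ->
  (forall a a' b b', \sum_(i < 4) s i * v i a a' * w i b b' =
                     \sum_(i < 4) c i * v' i a a' * w' i b b') ->
  perm_eq [seq `|s i| ^+ 2 | i <- enum 'I_4] [seq `|c i| ^+ 2 | i <- enum 'I_4].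
Proof.
move=> ov ow ov' ow' eq.
pose V (u : 'I_4 -> 'I_2 -> 'I_2 -> C) : 'M[C]_4 := \matrix_(k, i) u i (qfst k) (qsnd k).
pose S (z : 'I_4 -> C) : 'M[C]_4 := diag_mx (\row_i z i).
have uV u : orthonormal4 u -> adjmx (V u) *m V u = 1%:M.
  move=> ou; apply/matrixP => i j; rewrite !mxE sum_qidx -[RHS]/((i == j)%:R) eq_sym -ou.
  apply: eq_bigr => a _; apply: eq_bigr => b _.
  by rewrite !mxE qidxK1 qidxK2 mulrC.
have RR (z : 'I_4 -> C) u x : orthonormal4 u -> orthonormal4 x ->
    char_poly ((V u *m S z *m (V x)^T) *m adjmx (V u *m S z *m (V x)^T)) =
    \prod_(r <- [seq `|z i| ^+ 2 | i <- enum 'I_4]) ('X - r%:P).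
  move=> /uV uu /uV ux.
  have uVu : unitary (V u) by rewrite /unitary mulmx1C.
  have e : (V x)^T *m adjmx (V x)^T = 1%:M.
    rewrite /adjmx map_trmx trmxK -[LHS]trmxK trmx_mul trmxK.
    by rewrite -[_ *m _]/(adjmx (V x) *m V x) ux trmx1.
  rewrite !adjmxM !mulmxA -(mulmxA _ (V x)^T) e mulmx1.
  rewrite -(mulmxA (V u)) char_poly_unitary_conj //.
  have -> : S z *m adjmx (S z) = S (fun i => `|z i| ^+ 2).
    apply/matrixP => i j; rewrite mul_diag_mx !mxE normCK eq_sym.
    by case: eqP => [->|]; rewrite ?mulr1n ?mulr0n ?conjC0 ?mulr0.
  rewrite char_poly_trig ?diag_mx_is_trig // big_map big_enum /=.
  by apply: eq_bigr => i _; rewrite !mxE eqxx mulr1n.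
apply: prod_XsubC_eq; rewrite -(RR s v w) // -(RR c v' w') //.
have -> : V v *m S s *m (V w)^T = V v' *m S c *m (V w')^T; last by [].
apply/matrixP => i j; rewrite !mxE.
have := eq (qfst i) (qsnd i) (qfst j) (qsnd j).
rewrite (_ : \sum_(i0 < 4) s i0 * _ * _ = \sum_k (V v *m S s) i k * (V w)^T k j); last first.
  apply: eq_bigr => k _; rewrite mul_mx_diag !mxE; ring.
move=> ->; apply: eq_bigr => k _; rewrite mul_mx_diag !mxE; ring.
Qed.

End Schmidt.

(** * Pauli expansion *)

Section Pauli.
Variable C : numClosedFieldType.

(** The magic vectors are joint eigenvectors of the four operators [1], [XX], [YY], [ZZ], and the
    signs in entry [k] are the eigenvalues of the [k]th one. These are the coefficients of
    [magic_diag l] in that family. *)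
Definition coef (l : 'rV[C]_4) (k : 'I_4) : C :=
  let a := l 0 o0 in let b := l 0 o1 in let c := l 0 o2 in let d := l 0 o3 in
  nth 0 [:: (a + b + c + d) / 4%:R; (a - b + c - d) / 4%:R;
            (- a + b + c - d) / 4%:R; (a + b - c - d) / 4%:R] k.

Definition pauli (k : 'I_4) : 'M[C]_2 := \matrix_(i, j)
  nth 0 (nth [::] (nth [::] [:: [:: [:: 1; 0]; [:: 0; 1]];
                                [:: [:: 0; 1]; [:: 1; 0]];
                                [:: [:: 0; - 'i]; [:: 'i; 0]];
                                [:: [:: 1; 0]; [:: 0; - 1]]] k) i) j.

Lemma pauli_orthogonal i j : \tr (pauli i *m adjmx (pauli j)) = 2%:R * (i == j)%:R.
Proof.
move: i j; apply: ord4P; apply: ord4P; rewrite /mxtrace sum2 !mxE !sum2 !mxE /=;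
  rewrite ?rmorphN ?conjC0 ?conjC1 ?conjCi /= ?conjC0 ?conjC1 ?conjCi;
  first [by ring | by rewrite -[RHS](_ : 1 - 'i * 'i = _); [ring | rewrite ii; ring]
       | by rewrite -[RHS](_ : - 'i * 'i - 'i * 'i = _); [ring | rewrite mulNr ii; ring]].
Qed.

Lemma magic_diag_pauli l :
  magic_diag l = \sum_k coef l k *: kron2 (pauli k) (pauli k).
Proof.
set S := \sum_k _; suff e : magic C *m diag_mx l = S *m magic C.
  by rewrite /magic_diag e -mulmxA magic_unitary mulmx1.
have SE i j : S i j = \sum_k coef l k * (pauli k (qfst i) (qfst j) * pauli k (qsnd i) (qsnd j)).
  by rewrite /S summxE; apply: eq_bigr => k _; rewrite !mxE.
apply/matrixP; apply: ord4P; apply: ord4P;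
  rewrite mul_mx_diag ![in LHS]mxE [RHS]mxE !sum4 !SE !sum4 !qfstE !qsndE !mxE /coef /=;
  rewrite ?mulrNN ?(mulrN 'i) ?(mulNr 'i) ?ii;
  by field.
Qed.

(** Pauli matrices divided by [sqrt 2] are orthonormal and stay so after multiplication by unitaries
    on both sides. Hence the Pauli expansion is, up to phases of its coefficients, already a Schmidt
    decomposition of the Choi state. *)
Lemma kak_schmidt (A B A' B' : 'M[C]_2) (l : 'rV[C]_4) (s : 'I_4 -> C) v w U :
  unitary A -> unitary B -> unitary A' -> unitary B' ->
  U = kron2 A B *m magic_diag l *m kron2 A' B' ->
  orthonormal4 v -> orthonormal4 w ->
  (forall a a' b b', choi U a a' b b' = \sum_(i < 4) s i * v i a a' * w i b b') ->
  perm_eq [seq `|s i| ^+ 2 | i <- enum 'I_4] [seq `|coef l i| ^+ 2 | i <- enum 'I_4].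
Proof.
move=> uA uB uA' uB' UE ov ow hs.
pose u (X Y : 'M[C]_2) k a a' := h2 C * (X *m pauli k *m Y) a a'.
have ou X Y : unitary X -> unitary Y -> orthonormal4 (u X Y).
  move=> uX uY i j; transitivity (2^-1 * \tr (X *m pauli i *m Y *m adjmx (X *m pauli j *m Y))).
    rewrite mulr_sumr; apply: eq_bigr => a _; rewrite mxE mulr_sumr.
    apply: eq_bigr => a' _; rewrite /u -h2h2 rmorphM /= h2_conj !mxE; ring.
  rewrite !adjmxM !mulmxA -(mulmxA _ Y) uY mulmx1 -mulmxA mxtrace_mulC -!mulmxA.
  rewrite (mulmxA (adjmx X)) unitaryP // mul1mx mxtrace_mulC pauli_orthogonal.
  by rewrite mulrA mulVf ?mul1r // pnatr_eq0.
apply: (schmidt_unique ov ow (ou A A' uA uA') (ou B B' uB uB')) => a a' b b'.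
rewrite -hs /choi UE magic_diag_pauli mulmx_sumr mulmx_suml summxE mulr_sumr.
apply: eq_bigr => k _; rewrite -scalemxAr -scalemxAl !kron2M mxE.
have -> (X Y : 'M[C]_2) : kron2 X Y (qidx a b) (qidx a' b') = X a a' * Y b b'.
  by rewrite mxE !qidxK1 !qidxK2.
by rewrite /u -h2h2; ring.
Qed.

(* With [m] the list of conjugates (equivalently, inverses) of [l], these are the squared
   moduli of the coefficients; written this way the field tactic applies to them. *)
Definition sqcoef (l m : seq C) (k : 'I_4) : C :=
  let a := l`_0 in let b := l`_1 in let c := l`_2 in let d := l`_3 in
  let a' := m`_0 in let b' := m`_1 in let c' := m`_2 in let d' := m`_3 in
  nth 0 [:: (a + b + c + d) * (a' + b' + c' + d') / 16%:R;
            (a - b + c - d) * (a' - b' + c' - d') / 16%:R;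
            (- a + b + c - d) * (- a' + b' + c' - d') / 16%:R;
            (a + b - c - d) * (a' + b' - c' - d') / 16%:R] k.

Lemma coef_sq (l : 'rV[C]_4) k :
  `|coef l k| ^+ 2 = sqcoef [:: l 0 o0; l 0 o1; l 0 o2; l 0 o3]
    [:: (l 0 o0)^*; (l 0 o1)^*; (l 0 o2)^*; (l 0 o3)^*] k.
Proof.
rewrite normCK /coef /sqcoef /=; move: k; apply: ord4P;
  rewrite /= rmorphM fmorphV /= conjC_nat ?(rmorphB, rmorphD, rmorphN) /=; by field.
Qed.

(** Each difference of two squared moduli, times [8abcd], is a product of two linear factors and a
    quadratic one. The differences with [n o0] show that the quadratic factors and all the sums
    involved are nonzero; in the vanishing differences one linear factor must then be 0, which makes
    three of the four numbers equal. *)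
Lemma three_coef_equal (a b c d : C) : a != 0 -> b != 0 -> c != 0 -> d != 0 ->
  let n := sqcoef [:: a; b; c; d] [:: a^-1; b^-1; c^-1; d^-1] in
  n o1 != 0 -> n o0 != n o1 -> n o1 = n o2 -> n o2 = n o3 ->
  three_equal (fun k => nth 0 [:: a ^+ 2; b ^+ 2; c ^+ 2; d ^+ 2] k).
Proof.
move=> a0 b0 c0 d0 n n1 n01 n12 n23.
have abcd : 8%:R * a * b * c * d != 0 by rewrite !mulf_neq0 // pnatr_eq0.
have e12 : (a - b) * (c - d) * (a * b + c * d) = 0.
  transitivity ((n o2 - n o1) * (8%:R * a * b * c * d)).
    by rewrite /n /sqcoef /=; field; rewrite a0 b0 c0 d0.
  by rewrite n12 subrr mul0r.
have e23 : (a - c) * (b - d) * (a * c + b * d) = 0.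
  transitivity ((n o2 - n o3) * (8%:R * a * b * c * d)).
    by rewrite /n /sqcoef /=; field; rewrite a0 b0 c0 d0.
  by rewrite n23 subrr mul0r.
have e13 : (a - d) * (b - c) * (a * d + b * c) = 0.
  transitivity ((n o1 - n o3) * (8%:R * a * b * c * d)).
    by rewrite /n /sqcoef /=; field; rewrite a0 b0 c0 d0.
  by rewrite n12 n23 subrr mul0r.
have f1 : (a + c) * (b + d) * (a * c + b * d) != 0.
  have <- : (n o0 - n o1) * (8%:R * a * b * c * d) = (a + c) * (b + d) * (a * c + b * d).
    by rewrite /n /sqcoef /=; field; rewrite a0 b0 c0 d0.
  by rewrite mulf_neq0 // subr_eq0.
have f2 : (a + d) * (b + c) * (a * d + b * c) != 0.
  have <- : (n o0 - n o2) * (8%:R * a * b * c * d) = (a + d) * (b + c) * (a * d + b * c).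
    by rewrite /n /sqcoef /=; field; rewrite a0 b0 c0 d0.
  by rewrite mulf_neq0 // subr_eq0 -n12.
have f3 : (a + b) * (c + d) * (a * b + c * d) != 0.
  have <- : (n o0 - n o3) * (8%:R * a * b * c * d) = (a + b) * (c + d) * (a * b + c * d).
    by rewrite /n /sqcoef /=; field; rewrite a0 b0 c0 d0.
  by rewrite mulf_neq0 // subr_eq0 -n23 -n12.
move: f1 f2 f3; rewrite !mulf_eq0 !negb_or.
move=> /andP[/andP[ac bd] f1] /andP[/andP[ad bc] f2] /andP[/andP[ab cd] f3].
(* The fourth number is not the opposite of the others, since the sums are nonzero, and not equal to
   them, since [n o1] would vanish. *)
have neq (x y : C) : x + y != 0 -> (y == x -> n o1 = 0) -> y ^+ 2 != x ^+ 2.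
  move=> xy h; rewrite eqf_sqr negb_or; apply/andP; split.
    by apply: contra n1 => /h ->.
  by apply: contra xy => /eqP ->; rewrite subrr.
have all_eq : a = b -> a = c -> a = d -> n o1 = 0.
  by rewrite /n /sqcoef /= => <- <- <-; rewrite subrr add0r subrr !mul0r.
have D : (a = b /\ a = c) \/ (a = b /\ a = d) \/ (a = c /\ a = d) \/ (b = c /\ b = d).
  move: e12 e23 e13 => /eqP + /eqP + /eqP.
  rewrite !mulf_eq0 (negPf f1) (negPf f2) (negPf f3) !orbF !subr_eq0.
  by move=> /orP[] /eqP ? /orP[] /eqP ? _; subst; tauto.
case: D => [[e e']|[[e e']|[[e e']|[e e']]]].
- exists o3, (a ^+ 2); split; first by apply: neq => //= /eqP e2; apply: all_eq.
  by apply: ord4P => //=; rewrite -?e -?e'.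
- exists o2, (a ^+ 2); split; first by apply: neq => //= /eqP e2; apply: all_eq.
  by apply: ord4P => //=; rewrite -?e -?e'.
- exists o1, (a ^+ 2); split; first by apply: neq => //= /eqP e2; apply: all_eq.
  by apply: ord4P => //=; rewrite -?e -?e'.
exists o0, (b ^+ 2); split.
  by apply: neq; rewrite 1?addrC //= => /eqP e2; apply: all_eq; rewrite ?e2 -?e -?e'.
by apply: ord4P => //=; rewrite -?e -?e'.
Qed.

Lemma dominated_three_equal (l : 'rV[C]_4) : (forall k, l 0 k * (l 0 k)^* = 1) ->
  dominated (fun k => `|coef l k| ^+ 2) -> three_equal (fun k => l 0 k ^+ 2).
Proof.
move=> ul [j [t [t0 tj ht]]].
have l0 k : l 0 k != 0.
  by apply: contra_eq_neq (ul k) => ->; rewrite mul0r eq_sym oner_eq0.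
(* On the unit circle conjugation is inversion, which makes the squared moduli rational functions of
   [l]. *)
have lc k : (l 0 k)^* = (l 0 k)^-1 by apply: (mulfI (l0 k)); rewrite ul divff.
have tn0 : t != 0 by rewrite gt_eqF.
have {tj} := negbT (gt_eqF tj); rewrite coef_sq !lc.
have {}ht k : k != j -> sqcoef [:: l 0 o0; l 0 o1; l 0 o2; l 0 o3]
    [:: (l 0 o0)^-1; (l 0 o1)^-1; (l 0 o2)^-1; (l 0 o3)^-1] k = t.
  by move=> /ht; rewrite coef_sq !lc.
move: (l0 o0) (l0 o1) (l0 o2) (l0 o3) ht; clear ul l0 lc t0.
suff : forall a b c d : C, a != 0 -> b != 0 -> c != 0 -> d != 0 ->
   (forall k, k != j -> sqcoef [:: a; b; c; d] [:: a^-1; b^-1; c^-1; d^-1] k = t) ->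
   sqcoef [:: a; b; c; d] [:: a^-1; b^-1; c^-1; d^-1] j != t ->
   three_equal (fun k => nth 0 [:: a ^+ 2; b ^+ 2; c ^+ 2; d ^+ 2] k).
  move=> h a0 b0 c0 d0 h1 h2.
  have [k [x [kx xx]]] := h _ _ _ _ a0 b0 c0 d0 h1 h2; exists k, x; split.
    by move: k kx {xx}; apply: ord4P.
  by move=> i /xx; move: i; apply: ord4P.
move=> a b c d a0 b0 c0 d0.
(* Changing two signs permutes the squared moduli and keeps the squares. *)
have flip (e f g h : C) : e ^+ 2 = 1 -> f ^+ 2 = 1 -> g ^+ 2 = 1 -> h ^+ 2 = 1 ->
  let m := sqcoef [:: e * a; f * b; g * c; h * d]
             [:: (e * a)^-1; (f * b)^-1; (g * c)^-1; (h * d)^-1] in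
  m o1 = t -> m o0 != t -> m o2 = t -> m o3 = t ->
  three_equal (fun k => nth 0 [:: a ^+ 2; b ^+ 2; c ^+ 2; d ^+ 2] k).
  move=> e1 f1 g1 h1 m m1 m0 m2 m3.
  have nz (x : C) : x ^+ 2 = 1 -> x != 0.
    by move=> x1; apply: contra_eq_neq x1 => ->; rewrite expr0n eq_sym oner_eq0.
  suff : three_equal (fun k => nth 0 [:: (e * a) ^+ 2; (f * b) ^+ 2;
      (g * c) ^+ 2; (h * d) ^+ 2] k) by rewrite !exprMn e1 f1 g1 h1 !mul1r.
  apply: three_coef_equal; try by apply: mulf_neq0 => //; apply: nz.
  - by rewrite -/m m1.
  - by rewrite -/m m1.
  - by rewrite -/m m1 m2.
  by rewrite -/m m2 m3.
have n1 : (-1 : C) ^+ 2 = 1 by rewrite sqrrN expr1n.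
have p1 : (1 : C) ^+ 2 = 1 by rewrite expr1n.
move: j; apply: ord4P => ht tj.
- by apply: (flip 1 1 1 1) => //; rewrite !mul1r //; exact: ht.
- apply: (flip 1 (-1) 1 (-1)) => //; rewrite !mul1r !mulN1r !invrN.
  + by rewrite -(ht o0) // /sqcoef /=; ring.
  + by apply: contra tj => /eqP <-; apply/eqP; rewrite /sqcoef /=; ring.
  + by rewrite -(ht o3) // /sqcoef /=; ring.
  + by rewrite -(ht o2) // /sqcoef /=; ring.
- apply: (flip (-1) 1 1 (-1)) => //; rewrite !mul1r !mulN1r !invrN.
  + by rewrite -(ht o3) // /sqcoef /=; ring.
  + by apply: contra tj => /eqP <-; apply/eqP; rewrite /sqcoef /=; ring.
  + by rewrite -(ht o0) // /sqcoef /=; ring.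
  + by rewrite -(ht o1) // /sqcoef /=; ring.
apply: (flip 1 1 (-1) (-1)) => //; rewrite !mul1r !mulN1r !invrN.
+ by rewrite -(ht o2) // /sqcoef /=; ring.
+ by apply: contra tj => /eqP <-; apply/eqP; rewrite /sqcoef /=; ring.
+ by rewrite -(ht o1) // /sqcoef /=; ring.
+ by rewrite -(ht o0) // /sqcoef /=; ring.
Qed.

Ltac try_coef solve i0 e1 e2 e3 := apply: (solve i0);
  [| apply: ord4P => // _]; rewrite coef_sq /sqcoef /= e1 e2 e3 ?rmorphN /=; by field.

Ltac find_coef solvex solvemx e1 e2 e3 :=
  first [ try_coef solvex o0 e1 e2 e3 | try_coef solvex o1 e1 e2 e3
        | try_coef solvex o2 e1 e2 e3 | try_coef solvex o3 e1 e2 e3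
        | try_coef solvemx o0 e1 e2 e3 | try_coef solvemx o1 e1 e2 e3
        | try_coef solvemx o2 e1 e2 e3 | try_coef solvemx o3 e1 e2 e3].

(** Let [y] be the exceptional entry; the others are [x] or [-x]. For a suitable sign [z] of [x],
    one squared modulus is [g z = |y + 3z|^2 / 16] and the other three are [f z = |y - z|^2 / 16].
    As [|y| = |z| = 1], [g z - f z = |y + z|^2 / 4], and both gaps are strict because [y] is neither
    [z] nor [-z]. *)
Lemma three_equal_dominated (l : 'rV[C]_4) : (forall k, l 0 k * (l 0 k)^* = 1) ->
  three_equal (fun k => l 0 k ^+ 2) -> dominated (fun k => `|coef l k| ^+ 2).
Proof.
move=> ul [k [b [kb hb]]].
have l0 i : l 0 i != 0.
  by apply: contra_eq_neq (ul i) => ->; rewrite mul0r eq_sym oner_eq0.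
have [j jk] : exists j, j != k by move: k {kb hb}; apply: ord4P; [exists o1|exists o0..].
pose x := l 0 j; pose y := l 0 k.
have sgn i : i != k -> l 0 i = x \/ l 0 i = - x.
  move=> ik; have /eqP : l 0 i ^+ 2 = x ^+ 2 by rewrite (hb i ik) (hb j jk).
  by rewrite eqf_sqr => /orP[] /eqP; [left | right].
have yx : y ^+ 2 != x ^+ 2 by rewrite (hb j jk).
pose f (z : C) := (y - z) * (y^* - z^*) / 16%:R.
pose g (z : C) := (y + 3%:R * z) * (y^* + 3%:R * z^*) / 16%:R.
have p16 : 0 < 16%:R^-1 :> C by rewrite invr_gt0 ltr0n.
have fg z : z ^+ 2 = x ^+ 2 -> z * z^* = 1 -> 0 < f z /\ f z < g z.
  move=> zx zz; move: yx; rewrite -zx eqf_sqr negb_or => /andP[m p].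
  have pos (u : C) : u != 0 -> 0 < u * u^*.
    by move=> u0; rewrite -normCK exprn_gt0 // normr_gt0.
  split; first by rewrite /f -rmorphB mulr_gt0 // pos // subr_eq0.
  rewrite -subr_gt0; have -> : g z - f z = (y + z) * (y + z)^* / 4%:R.
    transitivity (((y + z) * (y + z)^* + (z * z^* - y * y^*)) / 4%:R).
      by rewrite /f /g rmorphD /=; field.
    by rewrite zz ul subrr addr0.
  by rewrite mulr_gt0 ?invr_gt0 ?ltr0n // pos // -[z]opprK subr_eq0.
have [xf xg] := fg x erefl (ul j).
have [mf mg] : 0 < f (- x) /\ f (- x) < g (- x).
  by apply: fg; rewrite ?sqrrN // rmorphN mulrNN ul.
have res (i0 : 'I_4) z : 0 < f z -> f z < g z -> `|coef l i0| ^+ 2 = g z ->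
    (forall i, i != i0 -> `|coef l i| ^+ 2 = f z) -> dominated (fun k => `|coef l k| ^+ 2).
  by move=> fz gz e h; exists i0, (f z); rewrite e.
have [solvex solvemx] : (forall i0 : 'I_4, `|coef l i0| ^+ 2 = g x ->
    (forall i, i != i0 -> `|coef l i| ^+ 2 = f x) -> dominated (fun k => `|coef l k| ^+ 2))
  /\ (forall i0 : 'I_4, `|coef l i0| ^+ 2 = g (- x) ->
    (forall i, i != i0 -> `|coef l i| ^+ 2 = f (- x)) -> dominated (fun k => `|coef l k| ^+ 2)).
  by split=> i0 e h; apply: (res i0 _ _ _ e h).
have case4 : [\/ k = o0, k = o1, k = o2 | k = o3].
  by clear; move: k; apply: ord4P; [constructor 1|constructor 2|constructor 3|constructor 4].
(* The eight sign patterns of the three other entries match the four coefficients combined with the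
   two signs of [x]; the tactic searches for the right pair. *)
case: case4 => ek; rewrite /g /f /y ek in solvex solvemx sgn; clear - solvex solvemx sgn.
- have [e1|e1] := sgn o1 isT; have [e2|e2] := sgn o2 isT; have [e3|e3] := sgn o3 isT;
    find_coef solvex solvemx e1 e2 e3.
- have [e1|e1] := sgn o0 isT; have [e2|e2] := sgn o2 isT; have [e3|e3] := sgn o3 isT;
    find_coef solvex solvemx e1 e2 e3.
- have [e1|e1] := sgn o0 isT; have [e2|e2] := sgn o1 isT; have [e3|e3] := sgn o3 isT;
    find_coef solvex solvemx e1 e2 e3.
have [e1|e1] := sgn o0 isT; have [e2|e2] := sgn o1 isT; have [e3|e3] := sgn o2 isT;
  find_coef solvex solvemx e1 e2 e3.
Qed.

End Pauli.

(** * Families of product inputs *)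

Section Protocols.
Variable C : numClosedFieldType.

Lemma star_protocol (U : 'M[C]_4) (e : 'I_4 -> entry C) : unitary U ->
  (forall i, valid_entry U (e i)) ->
  (forall i, \rank (eigenspace (Omega (e i)) 1) = 1%N) ->
  (forall i, inner (input (e o0)) (input (e i)) != 0) ->
  (forall z, (forall i, inner z (input (e i)) = 0) -> z = 0) ->
  let p := [:: e o0; e o1; e o2; e o3] in verifies U p /\ ordinary p.
Proof.
move=> uU ve re star span p.
have inp f : List.In f p -> exists i, f = e i.
  by move=> [<-|[<-|[<-|[<-|[]]]]]; [exists o0|exists o1|exists o2|exists o3].
have ho : ordinary p by move=> f /inp [i ->].
split=> //; apply: (verifies_star (e0 := e o0)) => //; first by move=> f /inp [i ->]; exact: ve.
- by left.
- by move=> f /inp [i ->].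
move=> z hz; apply: span; apply: ord4P; apply: hz.
- by left.
- by right; left.
- by right; right; left.
by right; right; right; left.
Qed.

(** The case in which the Schmidt bases of the output are the images of the computational basis
    under the local unitaries. *)
Lemma entangled_entry_ev (U : 'M[C]_4) x y (A B : 'M[C]_2) c c' a b : unitary U ->
  unit_vec x -> unit_vec y -> unitary A -> unitary B -> c != c' ->
  U *m kronv x y = kron2 A B *m
    (a *: kronv (ev C 0) (ev C c) + b *: kronv (ev C 1) (ev C c')) -> a != 0 ->
  exists e, [/\ valid_entry U e, input e = kronv x y, size (tests e) = 2%N &
    \rank (eigenspace (Omega e) 1) = 1%N].
Proof.
move=> uU ux uy uA uB cc eU a0.
have iev i j : inner (ev C i) (ev C j) = (i == j)%:R.
  rewrite innerE (bigD1 i) //= big1 => [|k ki]; rewrite !mxE.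
    by rewrite !eqxx !andbT conjC1 mul1r addr0.
  by rewrite (negPf ki) conjC0 mul0r.
have pev (X : 'M[C]_2) : unitary X -> proj1 (X *m ev C 0) + proj1 (X *m ev C 1) = 1%:M.
  move=> uX; rewrite /proj1 !adjmxM !mulmxA -mulmxDl -[RHS]uX; congr (_ *m _).
  rewrite -!mulmxA -mulmxDr -[RHS]mulmx1; congr (_ *m _).
  apply/matrixP; apply: ord2P; apply: ord2P;
    by rewrite !mxE !big_ord1 !mxE /= ?conjC0 ?conjC1; ring.
have proj : proj1 (B *m ev C c) + proj1 (B *m ev C c') = 1%:M.
  move: c c' cc {eU}; apply: ord2P; apply: ord2P => // _; rewrite ?pev //.
  by rewrite addrC pev.
move: eU; rewrite mulmxDr -!scalemxAr !kron2_kronv => eU.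
apply: (entangled_entry uU ux uy _ _ _ _ _ _ (pev A uA) proj eU a0);
  by rewrite /unit_vec inner_unitary // iev ?eqxx // (negPf cc).
Qed.

(** Both equations only see squares, so square roots of [u_k / N] may carry any signs. [f m] flips
    coordinate [m], and [f o0] flips none; then [<f o0, f m> = (N - 2 |u_m|) / N] for [m != o0],
    which is nonzero by the last hypothesis. *)
Lemma flip_family (d u : 'I_4 -> C) :
  (forall k, u k != 0) -> \sum_k u k = 0 -> \sum_k d k * u k = 0 ->
  (forall m, `|u m| * 2%:R != \sum_k `|u k|) ->
  exists f : 'I_4 -> 'cV[C]_4,
    [/\ forall m, unit_vec (f m) /\ sq (f m) = 0,
        forall m, \sum_k d k * f m k 0 ^+ 2 = 0,
        forall m, inner (f o0) (f m) != 0 &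
        forall z, (forall m, inner z (f m) = 0) -> z = 0].
Proof.
move=> u0 su sdu hu; pose N := \sum_k `|u k|.
have N0 : 0 < N.
  rewrite /N sum4 ltr_wpDr // ?ltr_wpDr ?normr_ge0 ?normr_gt0 //.
have n0 : 0 < sqrtC N by rewrite sqrtC_gt0.
have n0' : sqrtC N != 0 by rewrite gt_eqF.
have nc : (sqrtC N)^* = sqrtC N by rewrite (CrealP _) // gtr0_real.
pose s (m k : 'I_4) : C := if (k == m) && (m != o0) then -1 else 1.
have ss m k : s m k ^+ 2 = 1 by rewrite /s; case: ifP; rewrite ?sqrrN expr1n.
have sc m k : (s m k)^* = s m k by rewrite /s; case: ifP; rewrite ?rmorphN1 ?conjC1.
pose f m : 'cV[C]_4 := \col_k (s m k * (sqrtC (u k) / sqrtC N)).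
have f2 m k : f m k 0 ^+ 2 = u k / N.
  by rewrite mxE !exprMn ss mul1r exprVn !sqrtCK.
have ff m m' : inner (f m) (f m') = (\sum_k s m k * s m' k * `|u k|) / N.
  rewrite innerE mulr_suml; apply: eq_bigr => k _; rewrite !mxE !rmorphM /= sc.
  rewrite fmorphV /= nc -[in RHS](sqrtCK N) -[in RHS](sqrtCK (u k)) normrX normCK.
  by field.
exists f; split.
- move=> m; split; last first.
    by rewrite /sq; under eq_bigr do rewrite f2; rewrite -mulr_suml su mul0r.
  rewrite /unit_vec ff; under eq_bigr do rewrite -expr2 ss mul1r.
  by rewrite divff // gt_eqF.
- move=> m; under eq_bigr do rewrite f2 mulrA.
  by rewrite -mulr_suml sdu mul0r.
- move=> m; rewrite ff mulf_neq0 ?invr_eq0 ?(gt_eqF N0) //.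
  have s0 k : s o0 k = 1 by rewrite /s eqxx andbF.
  under eq_bigr do rewrite s0 mul1r.
  have [->|m0] := eqVneq m o0.
    by under eq_bigr do rewrite s0 mul1r; rewrite gt_eqF.
  rewrite (_ : \sum_k _ = N - `|u m| * 2%:R); first by rewrite subr_eq0 eq_sym.
  rewrite /N (bigD1 m) //= [in RHS](bigD1 m) //= /s eqxx m0 /=.
  rewrite (eq_bigr (fun k => `|u k|)) => [|k km]; last by rewrite (negPf km) mul1r.
  by ring.
move=> z hz; have sum0 : \sum_k (z k 0)^* * (sqrtC (u k) / sqrtC N) = 0.
  rewrite -[RHS](hz o0) innerE; apply: eq_bigr => k _.
  by rewrite mxE /s eqxx andbF mul1r.
have cancel k : (z k 0)^* * (sqrtC (u k) / sqrtC N) = 0 -> z k 0 = 0.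
  move/eqP; rewrite !mulf_eq0 conjC_eq0 invr_eq0 (negPf n0') sqrtC_eq0 (negPf (u0 k)).
  by rewrite !orbF => /eqP.
(* [f o0] and [f k] differ in coordinate [k] alone, so subtracting isolates it; coordinate [o0] is
   recovered afterwards. *)
have zk k : k != o0 -> z k 0 = 0.
  move=> k0; apply: cancel; set a := _ * _.
  have : a * 2%:R = \sum_i (z i 0)^* * (sqrtC (u i) / sqrtC N) - inner z (f k).
    rewrite innerE -sumrB (bigD1 k) //= big1 => [|i ik].
      by rewrite mxE /s eqxx k0 /= /a; ring.
    by rewrite mxE /s (negPf ik) /= mul1r subrr.
  rewrite sum0 hz subrr => /eqP; rewrite mulf_eq0 pnatr_eq0 orbF.
  by move/eqP.
apply/colP => i; rewrite mxE; have [->|/zk //] := eqVneq i o0; apply: cancel.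
move: sum0; rewrite (bigD1 o0) //= big1 ?addr0 // => k k0.
by rewrite zk // conjC0 mul0r.
Qed.

(** [u_m] and [d_m u_m] are the opposites of the sums over the other indices, and both sums attain
    equality in the triangle inequality. All summands then share a direction [t], respectively [t'],
    so every [d_k] is [t' / t]. *)
Lemma strict_triangle (d u : 'I_4 -> C) m : (forall k, `|d k| = 1) ->
  (forall k, u k != 0) -> \sum_k u k = 0 -> \sum_k d k * u k = 0 ->
  `|u m| * 2%:R = \sum_k `|u k| -> forall k, d k = d m.
Proof.
move=> ud u0 su sdu hm.
have um : \sum_(k | k != m) `|u k| = `|u m|.
  by move: hm; rewrite (bigD1 m) //= mulr_natr mulr2n => /addrI.
have e1 : \sum_(k | k != m) u k = - u m.
  by move/eqP: su; rewrite (bigD1 m) //= addrC addr_eq0 => /eqP.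
have e2 : \sum_(k | k != m) d k * u k = - (d m * u m).
  by move/eqP: sdu; rewrite (bigD1 m) //= addrC addr_eq0 => /eqP.
have [|t t1 ht] := @normC_sum_eq C _ (fun k => k != m) u.
  by rewrite e1 normrN um.
have [|t' t1' ht'] := @normC_sum_eq C _ (fun k => k != m)
    (fun k => d k * u k).
  by rewrite e2 normrN normrM ud mul1r -um; apply: eq_bigr => k _; rewrite normrM ud mul1r.
have t0 : t != 0 by rewrite -normr_eq0 (eqP t1) oner_eq0.
have dk k : k != m -> d k = t' / t.
  move=> km; apply: (mulIf (u0 k)); rewrite ht' // normrM ud mul1r [in RHS]ht //.
  by field.
have dm : d m = t' / t.
  apply: (mulIf (u0 m)); apply: oppr_inj; rewrite -e2 -mulrN -e1 mulr_sumr.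
  by apply: eq_bigr => k km; rewrite dk.
by move=> k; have [->//|km] := eqVneq k m; rewrite dk.
Qed.

(** Setting the last two unknowns to [a - b] and [t (a - b)] and solving for the first two gives
    [X t] and [Y t]; the disjunctions say that neither vanishes identically. *)
Lemma nonvanishing_relation (a b c d : C) : a != b ->
  (b != c) || (b != d) -> (a != c) || (a != d) ->
  exists x y z w, [/\ [&& x != 0, y != 0, z != 0 & w != 0],
    x + y + z + w = 0 & a * x + b * y + c * z + d * w = 0].
Proof.
move=> ab bcd acd.
pose X t : C := (b - c) + t * (b - d); pose Y t : C := (c - a) + t * (d - a).
have lin (p q t t' : C) : (p != 0) || (q != 0) -> t != t' ->
    (p + t * q != 0) || (p + t' * q != 0).
  move=> pq tt; rewrite -negb_and; apply: contraL pq => /andP[/eqP h /eqP h'].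
  have q0 : q = 0.
    apply/eqP; have : (t - t') * q = 0 by rewrite -(subrr (0 : C)) -{1}h -h'; ring.
    by move/eqP; rewrite mulf_eq0 subr_eq0 (negPf tt).
  by rewrite negb_or !negbK -[X in (X == 0) && _]addr0 -[X in _ + X](mulr0 t) -{1}q0 h q0 !eqxx.
have lX t t' : t != t' -> (X t != 0) || (X t' != 0).
  by apply: lin; rewrite !subr_eq0.
have lY t t' : t != t' -> (Y t != 0) || (Y t' != 0).
  by apply: lin; rewrite !subr_eq0 ![_ == a]eq_sym.
(* Two nonzero affine functions have at most one root each, so one of 1, 2, 3 avoids both. *)
have [t t0 /andP[xt yt]] : exists2 t : C, t != 0 & (X t != 0) && (Y t != 0).
  have n12 : (1 : C) != 2%:R by rewrite (eqr_nat C 1 2).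
  have n13 : (1 : C) != 3%:R by rewrite (eqr_nat C 1 3).
  have n23 : (2%:R : C) != 3%:R by rewrite eqr_nat.
  move: (lX _ _ n12) (lX _ _ n13) (lX _ _ n23) (lY _ _ n12) (lY _ _ n13) (lY _ _ n23).
  have [h1|h1] := boolP ((X 1 != 0) && (Y 1 != 0)).
    by exists 1; rewrite ?oner_eq0.
  have [h2|h2] := boolP ((X 2%:R != 0) && (Y 2%:R != 0)).
    by exists 2%:R; rewrite ?pnatr_eq0.
  move=> x12 x13 x23 y12 y13 y23; exists 3%:R; rewrite ?pnatr_eq0 //.
  move: h1 h2 x12 x13 x23 y12 y13 y23.
  by case: (X 1 != 0) (X 2%:R != 0) (X 3%:R != 0) (Y 1 != 0) (Y 2%:R != 0) (Y 3%:R != 0)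
     => [] [] [] [] [] [].
exists (X t), (Y t), (a - b), (t * (a - b)); split.
- by rewrite xt yt mulf_neq0 // subr_eq0 ab.
- by rewrite /X /Y; ring.
by rewrite /X /Y; ring.
Qed.

(** If all [d_k] agree, [strict_triangle] excludes nothing, but the second equation repeats the
    first and [u = (1,1,-1,-1)] works directly. Otherwise any solution without zeros is good enough,
    since equality in the triangle inequality would make the [d_k] agree. *)
Lemma generic_family (d : 'I_4 -> C) : (forall k, `|d k| = 1) -> ~ three_equal d ->
  exists f : 'I_4 -> 'cV[C]_4,
    [/\ forall m, unit_vec (f m) /\ sq (f m) = 0,
        forall m, \sum_k d k * f m k 0 ^+ 2 = 0,
        forall m, inner (f o0) (f m) != 0 &
        forall z, (forall m, inner z (f m) = 0) -> z = 0].
Proof.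
move=> ud nte.
have te k i j h : [:: o0; o1; o2; o3] =i [:: k; i; j; h] -> d i = d j -> d j = d h ->
    d k = d i.
  move=> mem ij jh; apply/eqP/negPn/negP => ki; apply: nte; exists k, (d i); split=> // x xk.
  have := mem x; rewrite !inE (negPf xk) /= => e.
  have : x \in [:: i; j; h].
    by rewrite !inE -e; move: x {xk e}; apply: ord4P.
  by rewrite !inE => /or3P[] /eqP -> //; rewrite ?ij ?jh.
have [all_eq|] := boolP [&& d o0 == d o1, d o0 == d o2 & d o0 == d o3].
  pose u (k : 'I_4) : C := nth 0 [:: 1; 1; -1; -1] k.
  apply: (@flip_family d u).
  - by apply: ord4P; rewrite /u /= ?oppr_eq0 oner_eq0.
  - by rewrite sum4 /u /=; ring.
  - by move: all_eq => /and3P[/eqP e1 /eqP e2 /eqP e3]; rewrite sum4 /u /= -e1 -e2 -e3; ring.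
  rewrite sum4 /u /= !normrN !normr1 => m.
  have -> : `|nth 0 [:: 1; 1; -1; -1] m| = 1 :> C 
    by move: m; apply: ord4P; rewrite /= ?normrN normr1.
  have -> : 1 + 1 + 1 + 1 = 4%:R :> C by ring.
  by rewrite mul1r eqr_nat.
move=> neq.
suff [u [u0 su sdu]] : exists u : 'I_4 -> C,
    [/\ forall k, u k != 0, \sum_k u k = 0 & \sum_k d k * u k = 0].
  apply: (flip_family u0 su sdu) => m; apply: contra neq => /eqP h.
  have e := strict_triangle ud u0 su sdu h.
  by rewrite !e !eqxx.
(* The involution [p] brings two different values of [d] to the first two places; the absence of
   three equal values supplies the other hypotheses of [nonvanishing_relation]. *)
have pick (p : 'I_4 -> 'I_4) :
    (forall F : 'I_4 -> C, \sum_k F k = F (p o0) + F (p o1) + F (p o2) + F (p o3)) ->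
    (forall k, p (p k) = k) -> [:: o0; o1; o2; o3] =i [:: p o0; p o1; p o2; p o3] ->
    d (p o0) != d (p o1) -> exists u : 'I_4 -> C,
    [/\ forall k, u k != 0, \sum_k u k = 0 & \sum_k d k * u k = 0].
  move=> ps pp pm n01.
  have [||x [y [z [w [/and4P[x0 y0 z0 w0] e1 e2]]]]] :=
     @nonvanishing_relation (d (p o0)) (d (p o1)) (d (p o2)) (d (p o3)) n01.
  - rewrite -negb_and; apply: contra n01 => /andP[/eqP e /eqP e'].
    by rewrite (te (p o0) (p o1) (p o2) (p o3)) // -e.
  - rewrite -negb_and; apply: contra n01 => /andP[/eqP e /eqP e'].
    rewrite eq_sym (te (p o1) (p o0) (p o2) (p o3)) // -?e // => k.
    by rewrite pm !inE orbCA.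
  exists (fun k => nth 0 [:: x; y; z; w] (p k)); split.
  - by move=> k; move: (p k); apply: ord4P.
  - by rewrite ps !pp.
  by rewrite ps !pp.
move: neq; rewrite !negb_and => /or3P[] n.
- by apply: (pick id) => //; exact: sum4.
- pose p (k : 'I_4) := nth o0 [:: o0; o2; o1; o3] k; apply: (pick p) => //.
  + by move=> F; rewrite sum4 /p /=; ring.
  + by apply: ord4P.
  + by apply: ord4P.
pose p (k : 'I_4) := nth o0 [:: o0; o3; o2; o1] k; apply: (pick p) => //.
+ by move=> F; rewrite sum4 /p /=; ring.
+ by apply: ord4P.
by apply: ord4P.
Qed.

End Protocols.

(** * The minimal number of settings of a unitary in canonical form *)

Section Main.
Variable C : numClosedFieldType.

(** Solutions of both equations have coordinate [k] equal to 0. Three independent ones have squares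
    [1/4, 1/4, -1/2] in the other coordinates, whence [r = sqrt 2] and [h = 1/2]. The fourth vector
    must leave this hyperplane: [(1, i) / sqrt 2] on [k] and [j1] is still a product input, but its
    output is entangled as [d k] differs from [b]. *)
Lemma exceptional_family (d : 'I_4 -> C) (k j1 j2 j3 : 'I_4) b :
  (forall F : 'I_4 -> C, \sum_i F i = F k + F j1 + F j2 + F j3) ->
  uniq [:: k; j1; j2; j3] -> d k != b -> (forall j, j != k -> d j = b) ->
  exists f : 'I_4 -> 'cV[C]_4,
    [/\ forall m, unit_vec (f m) /\ sq (f m) = 0,
        forall m, m != o3 -> \sum_i d i * f m i 0 ^+ 2 = 0,
        forall m, inner (f o0) (f m) != 0,
        forall z, (forall m, inner z (f m) = 0) -> z = 0 &
        \sum_i d i * f o3 i 0 ^+ 2 != 0 /\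
        forall i, i != k -> i != j1 -> f o3 i 0 = 0].
Proof.
move=> hS; rewrite /= !inE !negb_or => /and4P[/and3P[n1 n2 n3] /andP[n4 n5] n6 _] kb hb.
pose r : C := sqrtC 2%:R.
have rr : r * r = 2%:R by rewrite -expr2 sqrtCK.
have rc : r^* = r by rewrite (CrealP _) // gtr0_real // sqrtC_gt0 ltr0n.
have r0 : r != 0 by rewrite sqrtC_eq0 pnatr_eq0.
pose vec x y z w : 'cV[C]_4 :=
  \col_i (if i == k then x else if i == j1 then y else if i == j2 then z else w).
have vk x y z w : vec x y z w k 0 = x by rewrite mxE eqxx.
have v1 x y z w : vec x y z w j1 0 = y by rewrite mxE eq_sym (negPf n1) eqxx.
have v2 x y z w : vec x y z w j2 0 = z.
  by rewrite mxE eq_sym (negPf n2) eq_sym (negPf n4) eqxx.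
have v3 x y z w : vec x y z w j3 0 = w.
  by rewrite mxE eq_sym (negPf n3) eq_sym (negPf n5) eq_sym (negPf n6).
have vi x y z w x' y' z' w' : inner (vec x y z w) (vec x' y' z' w') =
    x^* * x' + y^* * y' + z^* * z' + w^* * w'.
  by rewrite innerE hS !vk !v1 !v2 !v3.
have vs x y z w : sq (vec x y z w) = x ^+ 2 + y ^+ 2 + z ^+ 2 + w ^+ 2.
  by rewrite /sq hS !vk !v1 !v2 !v3.
have vd x y z w : \sum_i d i * vec x y z w i 0 ^+ 2 =
    b * sq (vec x y z w) + (d k - b) * x ^+ 2.
  rewrite vs hS !vk !v1 !v2 !v3 (hb j1) ?(hb j2) ?(hb j3) 1?eq_sym //; ring.
pose h : C := 2%:R^-1.
have hc : h^* = h by rewrite /h fmorphV /= conjC_nat.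
have h0 : h != 0 by rewrite invr_eq0 pnatr_eq0.
pose f (m : 'I_4) : 'cV[C]_4 := nth 0 [:: vec 0 h h ('i * (r * h));
  vec 0 (- h) h ('i * (r * h)); vec 0 h (- h) ('i * (r * h));
  vec (h2 C) ('i * h2 C) 0 0] m.
have hh : 2%:R * (h * h) + r * r * (h * h) = 1 by rewrite rr /h; field.
have e22 : 2%:R * (h2 C * h2 C) = 1 by rewrite h2h2 divff // pnatr_eq0.
have i2 : ('i : C) ^+ 2 = -1 by rewrite sqrCi.
have cc : ('i * (r * h))^* = - 'i * (r * h) by rewrite !rmorphM /= conjCi rc hc.
have s0 : 2%:R * (h * h) + ('i * 'i) * (r * r) * (h * h) = 0.
  by rewrite ii rr; ring.
exists f; split.
- apply: ord4P; rewrite /f /= /unit_vec vi vs ?cc ?rmorphN ?rmorphM /= ?conjC0 ?conjCi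
    ?hc ?h2_conj; split.
  + by rewrite -[RHS]hh -[X in _ = _ + X]mul1r -[X in _ = _ + X * _]opprK -ii; ring.
  + by rewrite -[RHS]s0; ring.
  + by rewrite -[RHS]hh -[X in _ = _ + X]mul1r -[X in _ = _ + X * _]opprK -ii; ring.
  + by rewrite -[RHS]s0; ring.
  + by rewrite -[RHS]hh -[X in _ = _ + X]mul1r -[X in _ = _ + X * _]opprK -ii; ring.
  + by rewrite -[RHS]s0; ring.
  + transitivity (h2 C * h2 C - ('i * 'i) * (h2 C * h2 C)); first by ring.
    by rewrite ii -[RHS]e22; ring.
  transitivity (h2 C * h2 C + ('i * 'i) * (h2 C * h2 C)); first by ring.
  by rewrite ii; ring.
- apply: ord4P => // _; rewrite /f /= vd vs.
  + transitivity (b * (2%:R * (h * h) + ('i * 'i) * (r * r) * (h * h))); first by ring.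
    by rewrite s0 mulr0.
  + transitivity (b * (2%:R * (h * h) + ('i * 'i) * (r * r) * (h * h))); first by ring.
    by rewrite s0 mulr0.
  transitivity (b * (2%:R * (h * h) + ('i * 'i) * (r * r) * (h * h))); first by ring.
  by rewrite s0 mulr0.
- have q : - ('i * 'i) * (r * r) * (h * h) = h by rewrite ii rr /h; field.
  apply: ord4P; rewrite /f /= vi ?cc conjC0 ?hc.
  + rewrite (_ : _ + _ = 1) ?oner_eq0 //.
    by rewrite -[RHS]hh -[X in _ = _ + X]mul1r -[X in _ = _ + X * _]opprK -ii; ring.
  + rewrite (_ : _ + _ = h) // -[RHS]q; ring.
  + rewrite (_ : _ + _ = h) // -[RHS]q; ring.
  rewrite (_ : _ + _ = 'i * (h * h2 C)); last by ring.
  by rewrite !mulf_neq0 ?neq0Ci ?(gt_eqF (h2_gt0 C)) // h2_gt0.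
- move=> z hz.
  have zi x y z' w : inner z (vec x y z' w) = (z k 0)^* * x + (z j1 0)^* * y
      + (z j2 0)^* * z' + (z j3 0)^* * w by rewrite innerE hS !vk !v1 !v2 !v3.
  have z0 x (y : C) : x^* * y = 0 -> y != 0 -> x = 0.
    by move=> /eqP + y0; rewrite mulf_eq0 (negPf y0) orbF conjC_eq0 => /eqP.
  have := hz o0; have := hz o1; have := hz o2; have := hz o3.
  rewrite /f /= !zi => g3 g2 g1 g0.
  have z1 : z j1 0 = 0.
    apply: (z0 _ (2%:R * h)); last by rewrite mulf_neq0 // pnatr_eq0.
    by rewrite -[RHS](subrr (0 : C)) -[X in _ = X - _]g0 -[X in _ = _ - X]g1; ring.
  have z2 : z j2 0 = 0.
    apply: (z0 _ (2%:R * h)); last by rewrite mulf_neq0 // pnatr_eq0.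
    by rewrite -[RHS](subrr (0 : C)) -[X in _ = X - _]g0 -[X in _ = _ - X]g2; ring.
  have z3 : z j3 0 = 0.
    apply: (z0 _ ('i * (r * h))); last by rewrite !mulf_neq0 ?neq0Ci.
    by rewrite -[RHS]g0 z1 z2 conjC0; ring.
  have zk : z k 0 = 0.
    apply: (z0 _ (h2 C)); last by rewrite gt_eqF ?h2_gt0.
    by rewrite -[RHS]g3 z1 z2 z3 conjC0; ring.
  apply: inner_eq0; rewrite innerE hS zk z1 z2 z3 conjC0; ring.
split; last first.
  move=> i ik i1; rewrite /f /= mxE (negPf ik) (negPf i1).
  by case: ifP.
rewrite /f /= vd vs.
rewrite (_ : _ + _ = (d k - b) * (h2 C * h2 C)).
  by rewrite !mulf_neq0 ?subr_eq0 ?(gt_eqF (h2_gt0 C)).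
transitivity (b * (h2 C * h2 C + ('i * 'i) * (h2 C * h2 C)) + (d k - b) * (h2 C * h2 C)).
  by ring.
by rewrite ii; ring.
Qed.

Section Decomposed.
Variables (U : 'M[C]_4) (A B A' B' : 'M[C]_2) (l : 'rV[C]_4).
Hypotheses (uU : unitary U) (uA : unitary A) (uB : unitary B)
  (uA' : unitary A') (uB' : unitary B') (ul : forall k, l 0 k * (l 0 k)^* = 1)
  (UE : U = kron2 A B *m magic_diag l *m kron2 A' B').

Let K := kron2 A' B'.
Let uK : unitary K. Proof. exact: kron2_unitary. Qed.
(** The input with magic coordinates [phi] after the inner local unitary [K]. It is an isometric
    parametrization of all vectors. *)
Let inp phi : 'cV[C]_4 := adjmx K *m (magic C *m phi).

Let inp_inner phi chi : inner (inp phi) (inp chi) = inner phi chi.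
Proof.
by rewrite !inner_unitary //; [exact: magic_unitary | exact: unitary_adj].
Qed.

Let inp_inv psi : inp (adjmx (magic C) *m (K *m psi)) = psi.
Proof.
rewrite /inp !mulmxA -(mulmxA (adjmx K)) magic_unitary mulmx1.
by rewrite unitaryP // mul1mx.
Qed.

Let inner_inp z phi : inner z (inp phi) = inner (adjmx (magic C) *m (K *m z)) phi.
Proof. by rewrite -{1}(inp_inv z) inp_inner. Qed.

Let out_inp phi : U *m inp phi = kron2 A B *m (magic C *m (diag_mx l *m phi)).
Proof.
rewrite UE /inp -/K /magic_diag -!mulmxA (mulmxA K) uK mul1mx.
by rewrite (mulmxA (adjmx _) (magic C)) unitaryP ?mul1mx //; exact: magic_unitary.
Qed.

Let det_neq0 (X : 'M[C]_2) : unitary X -> \det X != 0.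
Proof.
move=> /(congr1 determinant); rewrite det_mulmx det1.
by apply: contra_eq_neq => ->; rewrite mul0r eq_sym oner_eq0.
Qed.

(** A local unitary multiplies [qf] by its two nonzero determinants, so being a product can be read
    off in magic coordinates, for inputs here and for outputs in [qf_out]. *)
Let qf_inp phi : (qf (inp phi) == 0) = (sq phi == 0).
Proof.
rewrite /inp /K kron2_adj qf_kron2 qf_magic !mulf_eq0.
by rewrite !(negPf (det_neq0 _)) ?invr_eq0 ?pnatr_eq0 //; exact: unitary_adj.
Qed.

Let qf_out phi : (qf (U *m inp phi) == 0) = (\sum_k l 0 k ^+ 2 * phi k 0 ^+ 2 == 0).
Proof.
rewrite out_inp qf_kron2 qf_magic !mulf_eq0 !(negPf (det_neq0 _)) //.
rewrite invr_eq0 pnatr_eq0 /= /sq; congr (_ == _).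
by apply: eq_bigr => k _; rewrite mul_diag_mx mxE exprMn.
Qed.

Let inp_product phi : unit_vec phi -> sq phi = 0 ->
  exists x y : 'cV[C]_2, [/\ unit_vec x, unit_vec y & inp phi = kronv x y].
Proof.
move=> u /eqP; rewrite -qf_inp => /eqP /qf_product [x [y e]].
have : unit_vec (inp phi) by rewrite /unit_vec inp_inner.
by rewrite e => /kronv_unit_factors.
Qed.

Let product_entry_inp phi : unit_vec phi -> sq phi = 0 ->
  \sum_k l 0 k ^+ 2 * phi k 0 ^+ 2 = 0 ->
  exists e, [/\ valid_entry U e, input e = inp phi, size (tests e) = 1%N,
    \rank (eigenspace (Omega e) 1) = 1%N &
    exists x y : 'cV[C]_2, output U e = kronv x y].
Proof.
move=> u s /eqP; rewrite -qf_out => /eqP /qf_product [x' [y' ho]].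
have [x [y [ux uy hi]]] := inp_product u s.
rewrite hi in ho; have [e [ve ie se re]] := product_entry uU ux uy ho.
exists e; split=> //; first by rewrite hi.
by exists x', y'; rewrite /output ie.
Qed.

Lemma mu_generic : ~ three_equal (fun k => l 0 k ^+ 2) ->
  is_mu U 4 /\ exists p, verifies U p /\ entanglement_free U p.
Proof.
move=> nte.
have nl k : `|l 0 k ^+ 2| = 1.
  by rewrite normrX normCK ul.
have [f [fu fd f0 fs]] := generic_family nl nte.
have /fin_all_exists [e he] : forall m, exists e,
    [/\ valid_entry U e, input e = inp (f m), size (tests e) = 1%N,
    \rank (eigenspace (Omega e) 1) = 1%N &
    exists x y : 'cV[C]_2, output U e = kronv x y].
  by move=> m; have [u s] := fu m; exact: product_entry_inp.
have [|||| ver ord] := @star_protocol _ U e uU.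
- by move=> i; case: (he i).
- by move=> i; case: (he i).
- by move=> i; case: (he o0) => _ -> _ _ _; case: (he i) => _ -> _ _ _; rewrite inp_inner.
- move=> z hz; rewrite -(inp_inv z) (fs (adjmx (magic C) *m (K *m z))) ?/inp ?mulmx0 // => m.
  by rewrite -inner_inp; case: (he m) => _ <- _ _ _.
split; last first.
  exists [:: e o0; e o1; e o2; e o3]; split=> // x.
  by move=> [<-|[<-|[<-|[<-|[]]]]]; 
    [case: (he o0)|case: (he o1)|case: (he o2)|case: (he o3)].
split; last first.
  by move=> p hv _; apply: leq_trans (settings_ge4 uU hv) (settings_ge_size hv.1).
exists [:: e o0; e o1; e o2; e o3]; split=> //.
have se i : size (tests (e i)) = 1%N by case: (he i).
by rewrite /settings !big_cons big_nil !se.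
Qed.

(** [j1] is the partner of [k] among the magic vectors: indices 0 and 1 span the same plane as [00],
    [11], and indices 2 and 3 the same plane as [01], [10]. A vector supported on [k] and [j1] is
    thus in Schmidt form over the computational basis. *)
Let exceptional_indices (k : 'I_4) : exists j1 j2 j3,
  [/\ forall F : 'I_4 -> C, \sum_i F i = F k + F j1 + F j2 + F j3,
      uniq [:: k; j1; j2; j3] &
      exists c c', c != c' /\ forall phi : 'cV[C]_4,
        (forall i, i != k -> i != j1 -> phi i 0 = 0) ->
        exists a b, magic C *m phi =
          a *: kronv (ev C 0) (ev C c) + b *: kronv (ev C 1) (ev C c')].
Proof.
have S01 (phi : 'cV[C]_4) : phi o2 0 = 0 -> phi o3 0 = 0 -> exists a b, magic C *m phi =
    a *: kronv (ev C 0) (ev C 0) + b *: kronv (ev C 1) (ev C 1).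
  move=> e2 e3; exists (h2 C * phi o0 0 + 'i * h2 C * phi o1 0),
    (h2 C * phi o0 0 - 'i * h2 C * phi o1 0).
  apply/colP; apply: ord4P; rewrite !mxE sum4 !mxE ?qfstE ?qsndE e2 e3 /=; ring.
have S23 (phi : 'cV[C]_4) : phi o0 0 = 0 -> phi o1 0 = 0 -> exists a b, magic C *m phi =
    a *: kronv (ev C 0) (ev C 1) + b *: kronv (ev C 1) (ev C 0).
  move=> e2 e3; exists ('i * h2 C * phi o2 0 + h2 C * phi o3 0),
    ('i * h2 C * phi o2 0 - h2 C * phi o3 0).
  apply/colP; apply: ord4P; rewrite !mxE sum4 !mxE ?qfstE ?qsndE e2 e3 /=; ring.
move: k; apply: ord4P; 
  [exists o1, o2, o3 | exists o0, o2, o3 | exists o3, o0, o1 | exists o2, o0, o1];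
  (split=> //; first by move=> F; rewrite sum4; ring).
- by exists 0, 1; split=> // phi h; apply: S01; apply: h.
- by exists 0, 1; split=> // phi h; apply: S01; apply: h.
- by exists 1, 0; split=> // phi h; apply: S23; apply: h.
by exists 1, 0; split=> // phi h; apply: S23; apply: h.
Qed.

Lemma mu_exceptional : three_equal (fun k => l 0 k ^+ 2) -> is_mu U 5.
Proof.
move=> [k [b [kb hb]]].
have [j1 [j2 [j3 [hS un [c [c' [cc hm]]]]]]] := exceptional_indices k.
have [f [fu fd f0 fs [fn fz]]] := exceptional_family hS un kb hb.
have /fin_all_exists [e he] : forall m, exists e,
    [/\ valid_entry U e, input e = inp (f m),
        size (tests e) = (if m == o3 then 2 else 1)%N &
    \rank (eigenspace (Omega e) 1) = 1%N].
  move=> m; have [u s] := fu m; case: eqP => [mE|/eqP m3]; last first.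
    by have [e [? ? ? ? _]] := product_entry_inp u s (fd m m3); exists e.
  have [x [y [ux uy ei]]] := inp_product u s.
  have [a [b' ab]] : exists a b', magic C *m (diag_mx l *m f m) =
      a *: kronv (ev C 0) (ev C c) + b' *: kronv (ev C 1) (ev C c').
    by apply: hm => i ik i1; rewrite mul_diag_mx mxE mE fz ?mulr0.
  have eU : U *m kronv x y = kron2 A B *m
      (a *: kronv (ev C 0) (ev C c) + b' *: kronv (ev C 1) (ev C c')).
    by rewrite -ei out_inp ab.
  (* With [a = 0] the output would be a product, whereas [fn] says that its determinant form is
     nonzero. *)
  have a0 : a != 0.
    apply: contraNneq fn => a0; rewrite -mE -qf_out ei eU a0 scale0r add0r.
    by rewrite -kronvZl kron2_kronv qf_kronv.
  have [e [? ie ? ?]] := entangled_entry_ev uU ux uy uA uB cc eU a0.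
  by exists e; split; rewrite // ie.
have [|||| ver ord] := @star_protocol _ U e uU.
- by move=> i; case: (he i).
- by move=> i; case: (he i).
- by move=> i; case: (he o0) => _ -> _ _; case: (he i) => _ -> _ _; rewrite inp_inner.
- move=> z hz; rewrite -(inp_inv z) (fs (adjmx (magic C) *m (K *m z))) ?/inp ?mulmx0 // => m.
  by rewrite -inner_inp; case: (he m) => _ <- _ _.
split.
  exists [:: e o0; e o1; e o2; e o3]; split=> //.
  have se i : size (tests (e i)) = (if i == o3 then 2 else 1)%N by case: (he i).
  by rewrite /settings !big_cons big_nil !se.
(* With at most four settings, the at least four entries would have one test each and therefore
   product outputs only. *)
move=> p hv ho; rewrite leqNgt; apply/negP => lt5.
have s4 := settings_ge4 uU hv; have sp := settings_ge_size hv.1.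
have eq4 : settings p = size p.
  by apply/eqP; rewrite eqn_leq sp andbT (leq_trans _ s4).
have single := settings_eq_size hv.1 eq4.
(* Product inputs with product outputs all miss the [k]th magic basis vector. *)
have miss x : List.In x p -> inner (inp (delta_mx k 0)) (input x) = 0.
  move=> inx; have vx : valid_entry U x := hv.1 x inx.
  have [x' [y' ox]] := single_test_product uU vx (ho x inx) (single x inx).
  pose phi := adjmx (magic C) *m (K *m input x).
  have ix : input x = inp phi by rewrite inp_inv.
  have q1 : sq phi = 0 by apply/eqP; rewrite -qf_inp -ix /input qf_kronv.
  have q2 : \sum_i l 0 i ^+ 2 * phi i 0 ^+ 2 = 0.
    by apply/eqP; rewrite -qf_out -ix -/(output U x) ox qf_kronv.
  (* Subtracting [b] times the first equation from the second leaves coordinate [k] alone. *)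
  have : (l 0 k ^+ 2 - b) * phi k 0 ^+ 2 = 0.
    move: q1 q2; rewrite /sq (bigD1 k) //= [X in _ -> X = _ -> _](bigD1 k) //=.
    rewrite [X in _ -> _ + X = _ -> _](eq_bigr (fun i => b * phi i 0 ^+ 2)); last first.
      by move=> i ik; rewrite hb.
    rewrite -mulr_sumr; set S := \sum_(i | _) _ => q1 q2.
    transitivity (l 0 k ^+ 2 * phi k 0 ^+ 2 + b * S - b * (phi k 0 ^+ 2 + S)).
      by ring.
    by rewrite q1 q2 mulr0 subrr.
  move/eqP; rewrite mulf_eq0 subr_eq0 (negPf kb) /= expf_eq0 /= => /eqP pk.
  rewrite ix inp_inner innerE (bigD1 k) //= pk mulr0 big1 ?addr0 // => i ik.
  by rewrite mxE (negPf ik) conjC0 mul0r.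
have := verifies_span uU hv miss => /(congr1 (fun v => inner v v)).
rewrite inner0r inp_inner innerE (bigD1 k) //= big1 => [|i ik]; rewrite !mxE.
  by rewrite !eqxx conjC1 mulr1 addr0 => /eqP; rewrite oner_eq0.
by rewrite (negPf ik) conjC0 mul0r.
Qed.

End Decomposed.
End Main.

Theorem theorem4 (C : numClosedFieldType) (U : 'M[C]_4) (s0 s1 s2 s3 : C) :
  unitary U -> schmidt_coeffs U s0 s1 s2 s3 ->
  s1 <= s0 -> s2 <= s1 -> s3 <= s2 ->
  ((s1 < s0 /\ s1 = s2 /\ s2 = s3 /\ 0 < s3) -> is_mu U 5) /\
  (~ (s1 < s0 /\ s1 = s2 /\ s2 = s3 /\ 0 < s3) ->
     is_mu U 4 /\ exists p, verifies U p /\ entanglement_free U p).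
Proof.
move=> uU [sge0 [v [w [ov [ow hs]]]]] h10 h21 h32.
have [A [B [A' [B' [l [[uA uB] [uA' uB'] ul UE]]]]]] := kak uU.
(* The given Schmidt decomposition and the Pauli one have the same squares up to order; [dominated]
   carries the condition from one to the other. *)
have pm := kak_schmidt uA uB uA' uB' UE ov ow hs.
have sd := sorted_dominated (sge0 o3) h10 h21 h32.
split=> [/sd/(dominated_perm pm)/(dominated_three_equal ul) te|nd].
  exact: (mu_exceptional uU uA uB uA' uB' UE te).
apply: (mu_generic uU uA uB uA' uB' ul UE) => /(three_equal_dominated ul) hd.
by apply/nd/sd/(dominated_perm _ hd); rewrite perm_sym.
Qed.
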